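(* Let $R$ be an associative ring with identity and let $Q$ be a locally target-finite and right rooted quiver. Then a representation $X$ in $\mathrm{Rep}(Q,R)$ is Gorenstein strongly fp-injective if and only if, for each vertex $i\in Q_0$, the $R$-modules $X(i)$ and $\mathrm{Ker}(\psi_i^X)$ are Gorenstein strongly fp-injective and the canonical homomorphism $\psi_i^X:X(i)\to\prod_{a\in Q_1,\,s(a)=i}X(t(a))$ is an epimorphism.
   Context: Modules are left $R$-modules; right $R$-modules are called $R^{\mathrm{op}}$-modules. A quiver $Q=(Q_0,Q_1)$ is a directed graph with vertex set $Q_0$ and arrow set $Q_1$; an arrow $a$ has source $s(a)$ and target $t(a)$. $\mathrm{Rep}(Q,R)$ is the abelian category of representations of $Q$ by $R$-modules, i.e. covariant functors from the (path category of the) quiver $Q$ to $R$-modules, with natural transformations as morphisms; $\mathrm{Hom}_Q$ denotes its Hom groups. $Q^{\mathrm{op}}$ is the quiver with the same vertices and all arrows reversed. $Q$ is locally target-finite if for every vertex $v$ the set of arrows with source $v$ is finite. $Q$ is right rooted if there is no infinite sequence of arrows $\bullet\to\bullet\to\bullet\to\cdots$ in $Q$. The map $\psi_i^X$ is the unique homomorphism whose component at an arrow $a$ with $s(a)=i$ is $X(a):X(i)\to X(t(a))$. Tensor product: for $X\in\mathrm{Rep}(Q,R)$ and an abelian group $G$, let $\mathrm{Hom}(X,G)\in\mathrm{Rep}(Q^{\mathrm{op}},R^{\mathrm{op}})$ be the representation with $\mathrm{Hom}(X,G)(i)=\mathrm{Hom}_{\mathbb Z}(X(i),G)$ and the induced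 maps on reversed arrows. The functor $\mathrm{Hom}(X,-):\mathbb{Z}\text{-Mod}\to\mathrm{Rep}(Q^{\mathrm{op}},R^{\mathrm{op}})$ has a left adjoint, denoted $-\otimes_Q X$. A short exact sequence $\eta$ in $\mathrm{Rep}(Q,R)$ is pure if $S\otimes_Q\eta$ is exact for every $S\in\mathrm{Rep}(Q^{\mathrm{op}},R^{\mathrm{op}})$; a long exact sequence is pure if all the short exact sequences into which it decomposes are pure. A representation $X$ is strongly fp-injective if there is a pure exact sequence $0\to X\to E^0\to E^1\to\cdots$ in $\mathrm{Rep}(Q,R)$ with every $E^i$ injective in $\mathrm{Rep}(Q,R)$. An $R$-module $L$ is strongly fp-injective if $\mathrm{Ext}^n_R(P,L)=0$ for every finitely presented $R$-module $P$ and all $n\ge 1$. An $R$-module $N$ is Gorenstein strongly fp-injective if it is a cycle module ($N=\mathrm{Z}_0E$, the kernel of the differential in degree $0$) of an exact complex $E$ (unbounded in both directions) of injective $R$-modules such that $\mathrm{Hom}_R(J,E)$ is exact for every strongly fp-injective $R$-module $J$. A representation $X$ is Gorenstein strongly fp-injective if there is an exact complex $\cdots\to I_1\to I_0\to I_{-1}\xrightarrow{f_{-1}}I_{-2}\to\cdots$ of injective representations with $X=\mathrm{Ker}(f_{-1})$ that remains exact after applying $\mathrm{Hom}_Q(J,-)$ for every strongly fp-injective representation $J$. *)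

(* Defs.v *)
From HB Require Import structures.
From mathcomp Require Import all_boot all_algebra.
From mathcomp Require Import boolp classical_sets cardinality.

Set Implicit Arguments.
Unset Strict Implicit.
Unset Printing Implicit Defensive.

Import GRing.Theory.
Local Open Scope ring_scope.
Local Open Scope quotient_scope.

(* A left R-module is an lmodType R; a right R-module is an lmodType R^c, where
   R^c is the opposite ring.  R is a pzRingType, so the zero ring is allowed. *)

Section Modules.
Variable R : pzRingType.
Implicit Types U V W : lmodType R.

Definition surj (A B : Type) (f : A -> B) : Prop := forall y, exists x, f x = y.

Definition exact_at (A B C : zmodType) (f : A -> B) (g : B -> C) :
  Prop := forall y, g y = 0 <-> exists x, f x = y.

Definition short_exact (A B C : zmodType) (f : A -> B) (g : B -> C) : Prop :=
  [/\ injective f, exact_at f g & surj g].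

Definition injective_module (E : lmodType R) : Prop :=
  forall U V (f : {linear U -> V}) (g : {linear U -> E}),
    injective f -> exists h : {linear V -> E}, forall x, h (f x) = g x.

Definition projective_module (P : lmodType R) : Prop :=
  forall U V (f : {linear U -> V}) (g : {linear P -> V}),
    surj f -> exists h : {linear P -> U}, forall x, f (h x) = g x.

Definition finitely_presented (P : lmodType R) : Prop :=
  exists (m n : nat) (f : {linear 'rV[R]_m -> 'rV[R]_n})
    (g : {linear 'rV[R]_n -> P}), exact_at f g /\ surj g.

(* Projective resolutions  ... -> P_2 -> P_1 -> P_0 -> M -> 0. *)
Record projective_resolution (M : lmodType R) := ProjectiveResolution {
  pres_obj :> nat -> lmodType R;
  pres_d : forall n, {linear pres_obj n.+1 -> pres_obj n};
  pres_aug : {linear pres_obj 0 -> M};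
  pres_projective : forall n, projective_module (pres_obj n);
  pres_surj : surj pres_aug;
  pres_exact0 : exact_at (pres_d 0) pres_aug;
  pres_exact : forall n, exact_at (pres_d n.+1) (pres_d n) }.

Definition coboundary (M L : lmodType R) (P : projective_resolution M)
    (n : nat) : {linear P n -> L} -> Prop :=
  match n return {linear P n -> L} -> Prop with
  | 0 => fun f => forall x, f x = 0
  | m.+1 => fun f => exists g : {linear P m -> L}, forall x, f x = g (pres_d P m x)
  end.

(* Ext^n_R(M, L) = 0, where Ext^n_R(M, L) is the n-th cohomology group of
   Hom_R(P, L) for a projective resolution P of M; as that group does not depend
   on P up to isomorphism, it is harmless to quantify over all P. *)
Definition Ext_zero (n : nat) (M L : lmodType R) : Prop :=
  forall (P : projective_resolution M) (f : {linear P n -> L}),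
    (forall x, f (pres_d P n x) = 0) -> coboundary f.

Definition strongly_fp_injective_module (L : lmodType R) : Prop :=
  forall P : lmodType R, finitely_presented P ->
    forall n, (1 <= n)%N -> Ext_zero n P L.

(* Exactness of Hom_R(J, A) -> Hom_R(J, B) -> Hom_R(J, C). *)
Definition Hom_exact_at (J A B C : lmodType R) (f : {linear A -> B})
    (g : {linear B -> C}) : Prop :=
  forall u : {linear J -> B},
    (forall x, g (u x) = 0) <->
    exists v : {linear J -> A}, forall x, f (v x) = u x.

(* N is isomorphic, via k, to Z_0 E, the kernel of E_0 -> E_(-1). *)
Definition Gorenstein_sfp_injective_module (N : lmodType R) : Prop :=
  exists (E : int -> lmodType R) (d : forall n, {linear E n -> E (n - 1)}),
  [/\ forall n, injective_module (E n),
      forall n, exact_at (d n) (d (n - 1)),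
      forall J, strongly_fp_injective_module J ->
        forall n, Hom_exact_at J (d n) (d (n - 1))
    & exists k : {linear N -> E 0}, injective k /\ exact_at k (d 0)].

End Modules.

Section KernelModule.
Variables (R : pzRingType) (U V : lmodType R) (f : {linear U -> V}).

Definition in_kernel : {pred U} := [pred x | f x == 0].

Fact in_kernel_closed : submod_closed in_kernel.
Proof.
split=> [|a x y]; rewrite !inE ?linear0 // => /eqP fx /eqP fy.
by rewrite linearP fx fy scaler0 addr0.
Qed.

HB.instance Definition _ := GRing.isSubmodClosed.Build R U in_kernel
  in_kernel_closed.

Definition kernel := {x : U | x \in in_kernel}.
HB.instance Definition _ := SubChoice.on kernel.
HB.instance Definition _ := [SubChoice_isSubLmodule of kernel by <:].

End KernelModule.

Section ProductModule.
Variables (R : pzRingType) (I : Type) (M : I -> lmodType R).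

Definition prodmod := forall i, M i.
Implicit Types f g h : prodmod.

HB.instance Definition _ := Choice.on prodmod.

Let addA : associative (fun f g : prodmod => (fun i => f i + g i) : prodmod).
Proof. by move=> f g h; apply: functional_extensionality_dep => i; rewrite addrA. Qed.
Let addC : commutative (fun f g : prodmod => (fun i => f i + g i) : prodmod).
Proof. by move=> f g; apply: functional_extensionality_dep => i; rewrite addrC. Qed.
Let add0 : left_id ((fun i => 0) : prodmod)
  (fun f g : prodmod => (fun i => f i + g i) : prodmod).
Proof. by move=> f; apply: functional_extensionality_dep => i; rewrite add0r. Qed.
Let addN : left_inverse ((fun i => 0) : prodmod)
  (fun f : prodmod => (fun i => - f i) : prodmod)
  (fun f g : prodmod => (fun i => f i + g i) : prodmod).
Proof. by move=> f; apply: functional_extensionality_dep => i; rewrite addNr. Qed.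

HB.instance Definition _ := GRing.isZmodule.Build prodmod addA addC add0 addN.

Let scale (a : R) f : prodmod := fun i => a *: f i.
Let scaleA a b f : scale a (scale b f) = scale (a * b) f.
Proof. by apply: functional_extensionality_dep => i; rewrite /scale scalerA. Qed.
Let scale1 : left_id 1 scale.
Proof. by move=> f; apply: functional_extensionality_dep => i; rewrite /scale scale1r. Qed.
Let scaleDr : right_distributive scale +%R.
Proof. by move=> a f g; apply: functional_extensionality_dep => i; rewrite /scale scalerDr. Qed.
Let scaleDl f : {morph scale^~ f : a b / a + b}.
Proof. by move=> a b; apply: functional_extensionality_dep => i; rewrite /scale scalerDl. Qed.

HB.instance Definition _ := GRing.Zmodule_isLmodule.Build R prodmod
  scaleA scale1 scaleDr scaleDl.

End ProductModule.

(* The right R-module Hom_Z(U, G). *)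
Section HomZ.
Variables (R : pzRingType) (U : lmodType R) (G : zmodType).

Definition homZ := {additive U -> G}.
Implicit Types f g h : homZ.

Lemma homZ_ext f g : (forall x, (f : {additive _ -> _}) x = (g : {additive _ -> _}) x) -> f = g.
Proof.
case: f g => [f [[fM]]] [g [[gM]]] /= fg.
have {}fg : f = g by apply: functional_extensionality_dep.
by subst g; rewrite (Prop_irrelevance fM gM).
Qed.

HB.instance Definition _ := gen_eqMixin homZ.
HB.instance Definition _ := gen_choiceMixin homZ.

Let add f g : homZ := (f : {additive _ -> _}) \+ (g : {additive _ -> _}).
Let opp f : homZ := \- (f : {additive _ -> _}).
Let zero : homZ := (\0 : U -> G).

Let addA : associative add.
Proof. by move=> f g h; apply: homZ_ext => x /=; rewrite addrA. Qed.
Let addC : commutative add.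
Proof. by move=> f g; apply: homZ_ext => x /=; rewrite addrC. Qed.
Let add0 : left_id zero add.
Proof. by move=> f; apply: homZ_ext => x /=; rewrite add0r. Qed.
Let addN : left_inverse zero opp add.
Proof. by move=> f; apply: homZ_ext => x /=; rewrite addNr. Qed.

HB.instance Definition _ := GRing.isZmodule.Build homZ addA addC add0 addN.

Let scale (a : R^c) f : homZ := (f : {additive _ -> _}) \o ( *:%R (a : R)).
Let scaleA a b f : scale a (scale b f) = scale (a * b) f.
Proof. by apply: homZ_ext => x /=; rewrite scalerA. Qed.
Let scale1 : left_id 1 scale.
Proof. by move=> f; apply: homZ_ext => x /=; rewrite scale1r. Qed.
Let scaleDr : right_distributive scale +%R.
Proof. by move=> a f g; apply: homZ_ext. Qed.
Let scaleDl f : {morph scale^~ f : a b / a + b}.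
Proof. by move=> a b; apply: homZ_ext => x /=; rewrite scalerDl raddfD. Qed.

HB.instance Definition _ := GRing.Zmodule_isLmodule.Build R^c homZ
  scaleA scale1 scaleDr scaleDl.

End HomZ.

(* arr i j is the type of arrows with source i and target j, so that
   Q_1 = {i & {j & arr i j}}. *)
Record quiver := Quiver { vert :> Type; arr : vert -> vert -> Type }.

Definition op_quiver (Q : quiver) : quiver := Quiver (fun i j => arr (q := Q) j i).

Definition out_arrow (Q : quiver) (i : Q) := {j : Q & arr i j}.

Definition locally_target_finite (Q : quiver) : Prop :=
  forall i : Q, finite_set [set: out_arrow i].

Definition right_rooted (Q : quiver) : Prop :=
  ~ exists v : nat -> Q, inhabited (forall n, arr (v n) (v n.+1)).

(* A functor out of the path category of Q is determined by its values on
   vertices and arrows, which may be prescribed freely. *)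
Record rep (R : pzRingType) (Q : quiver) := Rep {
  rep_obj :> Q -> lmodType R;
  rep_map : forall i j, arr i j -> {linear rep_obj i -> rep_obj j} }.

Record rep_hom (R : pzRingType) (Q : quiver) (X Y : rep R Q) := RepHom {
  rep_hom_at :> forall i, {linear X i -> Y i};
  rep_hom_natural : forall i j (a : arr i j) (x : X i),
    rep_hom_at j (rep_map X a x) = rep_map Y a (rep_hom_at i x) }.

(* Kernels, images, monomorphisms and epimorphisms in Rep(Q, R) are computed
   vertexwise. *)
Section RepExactness.
Variables (R : pzRingType) (Q : quiver).
Implicit Types X Y Z : rep R Q.

Definition rep_mono X Y (f : rep_hom X Y) : Prop := forall i, injective (f i).

Definition rep_epi X Y (f : rep_hom X Y) : Prop := forall i, surj (f i).

Definition rep_exact_at X Y Z (f : rep_hom X Y) (g : rep_hom Y Z) : Prop :=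
  forall i, exact_at (f i) (g i).

Definition rep_short_exact X Y Z (f : rep_hom X Y) (g : rep_hom Y Z) : Prop :=
  [/\ rep_mono f, rep_exact_at f g & rep_epi g].

Definition injective_rep (E : rep R Q) : Prop :=
  forall X Y (f : rep_hom X Y) (g : rep_hom X E),
    rep_mono f -> exists h : rep_hom Y E, forall i x, h i (f i x) = g i x.

(* Exactness of Hom_Q(J, X) -> Hom_Q(J, Y) -> Hom_Q(J, Z). *)
Definition rep_Hom_exact_at (J X Y Z : rep R Q) (f : rep_hom X Y)
    (g : rep_hom Y Z) : Prop :=
  forall u : rep_hom J Y,
    (forall i x, g i (u i x) = 0) <->
    exists v : rep_hom J X, forall i x, f i (v i x) = u i x.

End RepExactness.

Section HomRep.
Variables (R : pzRingType) (Q : quiver).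

Section Object.
Variables (X : rep R Q) (G : zmodType).

Definition hom_rep_map (i j : op_quiver Q) (a : arr i j) (f : homZ (X i) G) :
    homZ (X j) G :=
  (f : {additive _ -> _}) \o rep_map X (a : arr (q := Q) j i).

Fact hom_rep_map_linear i j (a : arr (q := op_quiver Q) i j) : linear (@hom_rep_map i j a).
Proof. by move=> r f g; apply: homZ_ext => x /=; rewrite linearZ. Qed.

HB.instance Definition _ i j (a : arr (q := op_quiver Q) i j) :=
  GRing.isLinear.Build R^c (homZ (X i) G) (homZ (X j) G) *:%R
    (@hom_rep_map i j a) (@hom_rep_map_linear i j a).

Definition hom_rep : rep R^c (op_quiver Q) :=
  Rep (rep_obj := fun i : op_quiver Q => homZ (X i) G) (fun i j a => @hom_rep_map i j a).

End Object.

(* Hom(f, G) : Hom(Y, G) -> Hom(X, G) for f : X -> Y. *)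
Section Morphism.
Variables (X Y : rep R Q) (f : rep_hom X Y) (G : zmodType).

Definition hom_rep_pre_at (i : op_quiver Q) (h : homZ (Y i) G) : homZ (X i) G :=
  (h : {additive _ -> _}) \o f i.

Fact hom_rep_pre_linear i : linear (@hom_rep_pre_at i).
Proof. by move=> r g h; apply: homZ_ext => x /=; rewrite linearZ. Qed.

HB.instance Definition _ i :=
  GRing.isLinear.Build R^c (homZ (Y i) G) (homZ (X i) G) *:%R
    (@hom_rep_pre_at i) (@hom_rep_pre_linear i).

Fact hom_rep_pre_natural i j (a : arr (q := op_quiver Q) i j) (h : hom_rep Y G i) :
  hom_rep_pre_at (rep_map (hom_rep Y G) a h) =
  rep_map (hom_rep X G) a (hom_rep_pre_at h).
Proof. by apply: homZ_ext => x /=; rewrite rep_hom_natural. Qed.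

Definition hom_rep_pre : rep_hom (hom_rep Y G) (hom_rep X G) :=
  RepHom (X := hom_rep Y G) (Y := hom_rep X G)
    (rep_hom_at := fun i => @hom_rep_pre_at i) hom_rep_pre_natural.

End Morphism.

Definition rep_comp_at (S : rep R Q) (T U : rep R Q) (g : rep_hom T U)
  (f : rep_hom S T) i : {linear S i -> U i} := g i \o f i.

Fact rep_comp_natural (S T U : rep R Q) (g : rep_hom T U) (f : rep_hom S T)
    i j (a : arr i j) (x : S i) :
  rep_comp_at g f j (rep_map S a x) = rep_map U a (rep_comp_at g f i x).
Proof. by rewrite /= !rep_hom_natural. Qed.

Definition rep_comp (S T U : rep R Q) (g : rep_hom T U) (f : rep_hom S T) :
  rep_hom S U := RepHom (rep_comp_natural g f).

End HomRep.

Arguments hom_rep {R Q} X G.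

(* S ⊗_Q X is built as the quotient of the formal sums of elements s ⊗ x, with
   s : S i and x : X i, by the relation identifying two sums that have the same
   value under every morphism S -> Hom(X, G), for all abelian groups G.
   Theorem tensor_adjunction shows that it is the value at S of the left adjoint
   of Hom(X, -). *)
Section Tensor.
Variables (R : pzRingType) (Q : quiver) (S : rep R^c (op_quiver Q)) (X : rep R Q).

Definition tensor_gen := {i : Q & (S i * X i)%type}.
Definition formal_sum := seq {classic tensor_gen}.

Definition gen_value (G : zmodType) (phi : rep_hom S (hom_rep X G))
    (k : tensor_gen) : G :=
  (phi (tag k) (tagged k).1 : {additive _ -> _}) (tagged k).2.

Definition sum_value (G : zmodType) (phi : rep_hom S (hom_rep X G))
    (w : formal_sum) : G := \sum_(k <- w) gen_value phi k.

Definition tensor_equiv (w w' : formal_sum) : bool :=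
  `[< forall (G : zmodType) (phi : rep_hom S (hom_rep X G)),
        sum_value phi w = sum_value phi w' >].

Fact tensor_equiv_refl : reflexive tensor_equiv.
Proof. by move=> w; apply/asboolP. Qed.
Fact tensor_equiv_sym : symmetric tensor_equiv.
Proof. by move=> w w'; apply/asboolP/asboolP => E G phi; rewrite E. Qed.
Fact tensor_equiv_trans : transitive tensor_equiv.
Proof.
by move=> w w' w'' /asboolP E /asboolP E'; apply/asboolP => G phi; rewrite E.
Qed.

Canonical tensor_equiv_rel :=
  EquivRel tensor_equiv tensor_equiv_refl tensor_equiv_sym tensor_equiv_trans.

Definition tensor := {eq_quot tensor_equiv}.
HB.instance Definition _ := Choice.on tensor.
HB.instance Definition _ : EqQuotient _ tensor_equiv tensor := EqQuotient.on tensor.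

Definition gen_opp (k : tensor_gen) : tensor_gen :=
  Tagged (fun i => (S i * X i)%type) (- (tagged k).1, (tagged k).2).

Lemma gen_value_opp G (phi : rep_hom S (hom_rep X G)) k :
  gen_value phi (gen_opp k) = - gen_value phi k.
Proof. by rewrite /gen_value /= linearN. Qed.

Lemma sum_value_cat G (phi : rep_hom S (hom_rep X G)) w w' :
  sum_value phi (w ++ w') = sum_value phi w + sum_value phi w'.
Proof. by rewrite /sum_value big_cat. Qed.

Lemma sum_value_opp G (phi : rep_hom S (hom_rep X G)) w :
  sum_value phi (map gen_opp w) = - sum_value phi w.
Proof.
by rewrite /sum_value big_map -sumrN; apply: eq_bigr => k _; rewrite gen_value_opp.
Qed.

Definition tensor_class (w : formal_sum) : tensor := \pi_tensor w.

Lemma tensor_classP w w' :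
  tensor_class w = tensor_class w' <->
  forall (G : zmodType) (phi : rep_hom S (hom_rep X G)),
    sum_value phi w = sum_value phi w'.
Proof.
split=> [/eqP|E]; first by rewrite eqmodE => /asboolP.
by apply/eqP; rewrite eqmodE; apply/asboolP.
Qed.

Lemma tensor_class_repr t : tensor_class (repr t) = t.
Proof. exact: reprK. Qed.

Definition tensor_lift_fun G (phi : rep_hom S (hom_rep X G)) (t : tensor) : G :=
  sum_value phi (repr t).

Lemma tensor_lift_class G (phi : rep_hom S (hom_rep X G)) w :
  tensor_lift_fun phi (tensor_class w) = sum_value phi w.
Proof. by apply/(tensor_classP _ _).1; rewrite tensor_class_repr. Qed.

Lemma tensor_separated (t t' : tensor) :
  (forall (G : zmodType) (phi : rep_hom S (hom_rep X G)),
    tensor_lift_fun phi t = tensor_lift_fun phi t') -> t = t'.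
Proof.
by move=> E; rewrite -[t]tensor_class_repr -[t']tensor_class_repr;
  apply/tensor_classP => G phi; apply: E.
Qed.

Let zero : tensor := tensor_class [::].
Let opp (t : tensor) : tensor := tensor_class (map gen_opp (repr t)).
Let add (t t' : tensor) : tensor := tensor_class (repr t ++ repr t').

Let lift0 G (phi : rep_hom S (hom_rep X G)) : tensor_lift_fun phi zero = 0.
Proof. by rewrite tensor_lift_class /sum_value big_nil. Qed.
Let liftN G (phi : rep_hom S (hom_rep X G)) t :
  tensor_lift_fun phi (opp t) = - tensor_lift_fun phi t.
Proof. by rewrite tensor_lift_class sum_value_opp. Qed.
Let liftD G (phi : rep_hom S (hom_rep X G)) t t' :
  tensor_lift_fun phi (add t t') = tensor_lift_fun phi t + tensor_lift_fun phi t'.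
Proof. by rewrite tensor_lift_class sum_value_cat. Qed.

Let addA : associative add.
Proof. by move=> t u v; apply: tensor_separated => G phi; rewrite !liftD addrA. Qed.
Let addC : commutative add.
Proof. by move=> t u; apply: tensor_separated => G phi; rewrite !liftD addrC. Qed.
Let add0 : left_id zero add.
Proof. by move=> t; apply: tensor_separated => G phi; rewrite liftD lift0 add0r. Qed.
Let addN : left_inverse zero opp add.
Proof. by move=> t; apply: tensor_separated => G phi; rewrite liftD liftN lift0 addNr. Qed.

HB.instance Definition _ := GRing.isZmodule.Build tensor addA addC add0 addN.

Fact tensor_lift_nmod_morphism G (phi : rep_hom S (hom_rep X G)) :
  nmod_morphism (tensor_lift_fun phi).
Proof. by split=> [|t u]; [apply: lift0 | apply: liftD]. Qed.

HB.instance Definition _ G (phi : rep_hom S (hom_rep X G)) :=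
  GRing.isNmodMorphism.Build tensor G (tensor_lift_fun phi)
    (tensor_lift_nmod_morphism phi).

(* The homomorphism S ⊗_Q X -> G adjoint to phi : S -> Hom(X, G). *)
Definition tensor_lift G (phi : rep_hom S (hom_rep X G)) : {additive tensor -> G} :=
  tensor_lift_fun phi.

Definition pure_tensor (i : Q) (s : S i) (x : X i) : tensor :=
  tensor_class [:: (Tagged (fun i => (S i * X i)%type) (s, x) : tensor_gen)].

Lemma tensor_lift_pure G (phi : rep_hom S (hom_rep X G)) i (s : S i) (x : X i) :
  tensor_lift phi (pure_tensor s x) = (phi i s : {additive _ -> _}) x.
Proof. by rewrite /= tensor_lift_class /sum_value big_seq1. Qed.

Fact pure_tensor_nmod_morphism i (s : S i) : nmod_morphism (@pure_tensor i s).
Proof.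
split=> [|x y]; apply: tensor_separated => G phi; have L := tensor_lift_pure phi.
  by rewrite L raddf0 (raddf0 (tensor_lift phi)).
by rewrite (raddfD (tensor_lift phi)) !L raddfD.
Qed.

HB.instance Definition _ i (s : S i) :=
  GRing.isNmodMorphism.Build (X i) tensor (@pure_tensor i s)
    (pure_tensor_nmod_morphism s).

Definition tensor_unit_at (i : op_quiver Q) (s : S i) : homZ (X i) tensor :=
  @pure_tensor i s.

Fact tensor_unit_linear i : linear (@tensor_unit_at i).
Proof.
move=> r s s'; apply: homZ_ext => x; apply: tensor_separated => G phi.
have L := tensor_lift_pure phi.
by rewrite /= (raddfD (tensor_lift phi)) !L linearP.
Qed.

HB.instance Definition _ i :=
  GRing.isLinear.Build R^c (S i) (homZ (X i) tensor) *:%R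
    (@tensor_unit_at i) (@tensor_unit_linear i).

Fact tensor_unit_natural (i j : op_quiver Q) (a : arr i j) (s : S i) :
  tensor_unit_at (rep_map S a s) =
  rep_map (hom_rep X tensor) a (tensor_unit_at s).
Proof.
apply: homZ_ext => x; apply: tensor_separated => G phi.
have L := tensor_lift_pure phi.
by rewrite /= !L rep_hom_natural.
Qed.

(* The unit S -> Hom(X, S ⊗_Q X) of the adjunction. *)
Definition tensor_unit : rep_hom S (hom_rep X tensor) :=
  RepHom (X := S) (Y := hom_rep X tensor)
    (rep_hom_at := fun i => @tensor_unit_at i) tensor_unit_natural.

Theorem tensor_adjunction (G : zmodType) (phi : rep_hom S (hom_rep X G)) :
  (forall i (s : S i) (x : X i),
     tensor_lift phi ((tensor_unit i s : {additive _ -> _}) x) =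
     (phi i s : {additive _ -> _}) x) /\
  (forall h : {additive tensor -> G},
     (forall i (s : S i) (x : X i),
        h ((tensor_unit i s : {additive _ -> _}) x) =
        (phi i s : {additive _ -> _}) x) ->
     forall t, h t = tensor_lift phi t).
Proof.
split=> [i s x|h hE t]; first exact: tensor_lift_pure.
rewrite -[t]tensor_class_repr; elim: (repr t) => [|[i [s x]] w IH].
  have -> : tensor_class [::] = 0 by [].
  by rewrite raddf0 [RHS]raddf0.
have -> : tensor_class (Tagged (fun i => (S i * X i)%type) (s, x) :: w) =
    pure_tensor s x + tensor_class w.
  apply: tensor_separated => H psi.
  rewrite (raddfD (tensor_lift psi)) /= !tensor_lift_class.
  by rewrite /sum_value big_cons big_seq1.
rewrite raddfD [RHS]raddfD IH; congr (_ + _).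
by rewrite tensor_lift_pure -hE.
Qed.

End Tensor.

(* S ⊗_Q f, induced on left adjoints by Hom(f, -). *)
Definition tensor_map (R : pzRingType) (Q : quiver) (S : rep R^c (op_quiver Q))
    (X Y : rep R Q) (f : rep_hom X Y) : {additive tensor S X -> tensor S Y} :=
  tensor_lift (rep_comp (hom_rep_pre f (tensor S Y)) (tensor_unit S Y)).

Lemma tensor_map_pure (R : pzRingType) (Q : quiver) (S : rep R^c (op_quiver Q))
    (X Y : rep R Q) (f : rep_hom X Y) i (s : S i) (x : X i) :
  tensor_map S f (pure_tensor s x) = pure_tensor s (f i x).
Proof. exact: tensor_lift_pure. Qed.

Section GorensteinRep.
Variables (R : pzRingType) (Q : quiver).
Implicit Types X Y Z : rep R Q.

Definition pure_short_exact X Y Z (f : rep_hom X Y) (g : rep_hom Y Z) : Prop :=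
  rep_short_exact f g /\
  forall S : rep R^c (op_quiver Q), short_exact (tensor_map S f) (tensor_map S g).

(* The exact sequence 0 -> X -> E 0 -> E 1 -> ... is pure: every short exact
   sequence 0 -> A -> E n -> B -> 0 coming from a factorization of
   E n -> E n.+1 through its image B is pure.  For n = 0, A is X up to
   isomorphism. *)
Definition pure_coresolution X (E : nat -> rep R Q) (e : rep_hom X (E 0))
    (d : forall n, rep_hom (E n) (E n.+1)) : Prop :=
  [/\ rep_mono e,
      rep_exact_at e (d 0),
      forall n, rep_exact_at (d n) (d n.+1)
    & forall n (A B : rep R Q) (u : rep_hom A (E n)) (p : rep_hom (E n) B)
        (m : rep_hom B (E n.+1)),
        rep_short_exact u p -> rep_mono m ->
        (forall i x, m i (p i x) = d n i x) -> pure_short_exact u p].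

Definition strongly_fp_injective_rep X : Prop :=
  exists (E : nat -> rep R Q) (e : rep_hom X (E 0))
    (d : forall n, rep_hom (E n) (E n.+1)),
    (forall n, injective_rep (E n)) /\ pure_coresolution e d.

(* X is isomorphic, via k, to the kernel of f_(-1) : I_(-1) -> I_(-2). *)
Definition Gorenstein_sfp_injective_rep X : Prop :=
  exists (I : int -> rep R Q) (f : forall n, rep_hom (I n) (I (n - 1))),
  [/\ forall n, injective_rep (I n),
      forall n, rep_exact_at (f n) (f (n - 1)),
      forall J, strongly_fp_injective_rep J ->
        forall n, rep_Hom_exact_at J (f n) (f (n - 1))
    & exists k : rep_hom X (I (- 1)), rep_mono k /\ rep_exact_at k (f (- 1))].

End GorensteinRep.

Section Psi.
Variables (R : pzRingType) (Q : quiver) (X : rep R Q) (i : Q).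

Definition psi_fun (x : X i) : prodmod (fun a : out_arrow i => X (tag a)) :=
  fun a => rep_map X (tagged a) x.

Fact psi_linear : linear psi_fun.
Proof. by move=> r x y; apply: functional_extensionality_dep => a; exact: linearP. Qed.

HB.instance Definition _ :=
  GRing.isLinear.Build R (X i) (prodmod (fun a : out_arrow i => X (tag a))) *:%R
    psi_fun psi_linear.

Definition psi : {linear X i -> prodmod (fun a : out_arrow i => X (tag a))} :=
  psi_fun.

End Psi.

(* Main.v *)
(* Write C(E) for the cofree representation on a family E of modules, with
   C(E)(i) the product of the E(j) over all paths i -> j; Hom_Q(Y, C(E)) is the
   product of the Hom_R(Y(j), E(j)), psi_i is split epi on C(E), with kernel E(i),
   and injective representations are the retracts of the C(E) with E injective.
   Only finitely many paths leave a vertex, so that C preserves pure exact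
   sequences and C(E) is strongly fp-injective when all E(j) are.  Conversely the
   values of a strongly fp-injective representation are strongly fp-injective.

   Let X be a cycle of a complex I as in the definition and let L be strongly
   fp-injective.  The stalk of L at i is the kernel of an epimorphism between two
   strongly fp-injective C(E), so that Hom_R(L, Ker psi_i^I), the group of maps from
   the stalk to I, is exact.  Then so is Hom_R(L, I(i)), by well-founded induction
   on i along 0 -> Ker psi_i -> I(i) -> prod I(t(a)) -> 0.

   Representations X with psi_i^X epi and Ker psi_i^X Gorenstein strongly
   fp-injective are closed under syzygies and cosyzygies formed with the C(E), and
   morphisms from strongly fp-injective representations lift along epimorphisms
   with kernel such an X (vertex by vertex); splicing gives the complex I. *)
From HB Require Import structures.
From mathcomp Require Import all_boot all_algebra.
From mathcomp Require Import boolp classical_sets functions cardinality filter.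
Require Import Defs.

Set Implicit Arguments.
Unset Strict Implicit.
Unset Printing Implicit Defensive.

Import GRing.Theory Num.Theory.
Local Open Scope ring_scope.
Local Open Scope quotient_scope.

(** * Linear maps and quotients *)

(** Strong fp-injectivity is defined through Ext for modules and through tensor products for
    representations; [fp_lifting], the lifting of maps from finitely presented modules, mediates
    between the two. From tensor products to lifting, a test representation Hom(X, G) turns purity
    into the solvability of finite linear systems at a vertex. In the other direction the obstacle
    is that a pure monomorphism need not split. It does have functions backwards that satisfy any
    finite list of instances of linearity and of being a retraction; indexed by such lists and taken
    modulo a filter, they act as a retraction into a reduced power. This passes to C(E): applied in
    each coordinate the functions are strictly natural, and an instance for C(E)(i) is one instance
    for each of the finitely many paths leaving i. *)

Lemma dep_choice (I : Type) (T : I -> Type) (P : forall i, T i -> Prop) :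
  (forall i, exists y, P i y) -> exists f : forall i, T i, forall i, P i (f i).
Proof.
by move=> ex; exists (fun i => projT1 (cid (ex i))) => i; case: (cid (ex i)).
Qed.

Section Linear.
Variable R : pzRingType.
Implicit Types U V W : lmodType R.

Section OfFun.
Variables (U V : lmodType R) (f : U -> V) (f_lin : linear f).
Definition linear_of_fun of linear f := f.
HB.instance Definition _ :=
  GRing.isLinear.Build R U V *:%R (linear_of_fun f_lin) f_lin.
Definition linear_of : {linear U -> V} := linear_of_fun f_lin.
End OfFun.

(** [P] is the graph of a linear map given as a relation: two values at the same vector differ by a
    value at 0, hence agree. Maps known only through equations on their values are obtained this
    way. *)
Lemma linear_of_rel U V (P : U -> V -> Prop) :
    (forall u, exists v, P u v) ->
    (forall a u u' v v', P u v -> P u' v' -> P (a *: u + u') (a *: v + v')) ->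
    (forall v, P 0 v -> v = 0) ->
  exists f : {linear U -> V}, forall u, P u (f u).
Proof.
move=> tot lin inj; have [f fP] := choice tot.
suff f_lin : linear f by exists (linear_of f_lin).
move=> a u u'; have := lin (-1) _ _ _ _ (lin a _ _ _ _ (fP u) (fP u')) (fP (a *: u + u')).
by rewrite !scaleN1r addNr => /inj/eqP; rewrite addr_eq0 => /eqP/oppr_inj.
Qed.

Lemma injective_eq0 U V (e : {linear U -> V}) :
  injective e -> forall x, e x = 0 <-> x = 0.
Proof.
by move=> e_inj x; split=> [|->]; [rewrite -(linear0 e) => /e_inj | apply: linear0].
Qed.

Lemma lift_inj U V W (e : {linear V -> W}) (u : {linear U -> W}) :
  injective e -> (forall x, exists y, e y = u x) ->
  exists v : {linear U -> V}, forall x, e (v x) = u x.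
Proof.
move=> e_inj im; apply: (linear_of_rel (P := fun x y => e y = u x)) => //.
  by move=> a x x' y y' Ey Ey'; rewrite !linearP Ey Ey'.
by move=> v; rewrite linear0 -(linear0 e) => /e_inj.
Qed.

Lemma factor_surj U V W (q : {linear U -> V}) (u : {linear U -> W}) :
  surj q -> (forall x, q x = 0 -> u x = 0) ->
  exists v : {linear V -> W}, forall x, v (q x) = u x.
Proof.
move=> q_surj ker.
have [||v|f fP] := @linear_of_rel V W (fun y z => exists2 x, q x = y & u x = z).
- by move=> y; have [x <-] := q_surj y; exists (u x); exists x.
- move=> a y y' z z' [x <- <-] [x' <- <-].
  by exists (a *: x + x'); rewrite linearP.
- by case=> x /ker -> <-.
exists f => x; have [x' qx' <-] := fP (q x).
apply/eqP; rewrite -subr_eq0 -linearB; apply/eqP/ker.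
by rewrite linearB qx' subrr.
Qed.

End Linear.

Section KernelInclusion.
Variables (R : pzRingType) (U V : lmodType R) (f : {linear U -> V}).

Fact kernel_val_linear : linear (val : kernel f -> U).
Proof. by []. Qed.

Definition kernel_incl : {linear kernel f -> U} := linear_of kernel_val_linear.

Lemma kernel_incl_inj : injective kernel_incl.
Proof. exact: val_inj. Qed.

Lemma kernel_incl_exact : exact_at kernel_incl f.
Proof.
move=> x; split=> [fx0|[[y /= fy0] <-]]; last by apply/eqP; exact: fy0.
have xP : x \in in_kernel f by apply/eqP.
by exists (Sub x xP); apply: SubK.
Qed.

End KernelInclusion.

Section QuotientGroup.
Variable V : zmodType.

Record subgroup := Subgroup {
  subgroup_pred :> V -> Prop;
  subgroup0 : subgroup_pred 0;
  subgroupB : forall x y,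
    subgroup_pred x -> subgroup_pred y -> subgroup_pred (x - y) }.

Variable N : subgroup.

Lemma subgroupN x : N x -> N (- x).
Proof. by move=> Nx; rewrite -sub0r; apply: subgroupB => //; apply: subgroup0. Qed.

Lemma subgroupD x y : N x -> N y -> N (x + y).
Proof. by move=> Nx Ny; rewrite -[y]opprK; apply/subgroupB/subgroupN. Qed.

Definition quot_equiv (x y : V) : bool := `[< N (x - y) >].

Fact quot_equiv_refl : reflexive quot_equiv.
Proof. by move=> x; apply/asboolP; rewrite subrr; apply: subgroup0. Qed.
Fact quot_equiv_sym : symmetric quot_equiv.
Proof.
by move=> x y; apply/asboolP/asboolP => /subgroupN; rewrite opprB.
Qed.
Fact quot_equiv_trans : transitive quot_equiv.
Proof.
move=> y x z /asboolP Nxy /asboolP Nyz; apply/asboolP.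
by rewrite -(subrK y x) -addrA; apply: subgroupD.
Qed.

Canonical quot_equiv_rel :=
  EquivRel quot_equiv quot_equiv_refl quot_equiv_sym quot_equiv_trans.

Definition quot := {eq_quot quot_equiv}.
HB.instance Definition _ := Choice.on quot.
HB.instance Definition _ : EqQuotient _ quot_equiv quot := EqQuotient.on quot.

Definition quot_class (x : V) : quot := \pi_quot x.

Lemma quot_classP x y : quot_class x = quot_class y <-> N (x - y).
Proof.
split=> [/eqP|Nxy]; first by rewrite eqmodE => /asboolP.
by apply/eqP; rewrite eqmodE; apply/asboolP.
Qed.

Lemma quot_classK z : exists x, quot_class x = z.
Proof. by exists (repr z); apply: reprK. Qed.

Let reprP x : N (repr (quot_class x) - x).
Proof. by apply/quot_classP; apply: reprK. Qed.

Let zero : quot := quot_class 0.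
Let opp (z : quot) : quot := quot_class (- repr z).
Let add (z t : quot) : quot := quot_class (repr z + repr t).

Let oppE x : opp (quot_class x) = quot_class (- x).
Proof. by apply/quot_classP; rewrite -opprD; apply/subgroupN/reprP. Qed.
Let addE x y : add (quot_class x) (quot_class y) = quot_class (x + y).
Proof. by apply/quot_classP; rewrite opprD addrACA; apply: subgroupD. Qed.

Let addA : associative add.
Proof.
move=> z t u; have [[[x <-] [y <-]] [v <-]] := (quot_classK z, quot_classK t, quot_classK u).
by rewrite !addE addrA.
Qed.
Let addC : commutative add.
Proof.
by move=> z t; have [[x <-] [y <-]] := (quot_classK z, quot_classK t); rewrite !addE addrC.
Qed.
Let add0 : left_id zero add.
Proof. by move=> z; have [x <-] := quot_classK z; rewrite addE add0r. Qed.
Let addN : left_inverse zero opp add.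
Proof. by move=> z; have [x <-] := quot_classK z; rewrite oppE addE addNr. Qed.

HB.instance Definition _ := GRing.isZmodule.Build quot addA addC add0 addN.

Fact quot_class_nmod_morphism : nmod_morphism quot_class.
Proof. by split=> [|x y] //; rewrite -addE. Qed.

HB.instance Definition _ :=
  GRing.isNmodMorphism.Build V quot quot_class quot_class_nmod_morphism.

Definition quot_proj : {additive V -> quot} := quot_class.

Lemma quot_proj_surj : surj quot_proj.
Proof. exact: quot_classK. Qed.

Lemma quot_proj_eq0 x : quot_proj x = 0 <-> N x.
Proof.
by rewrite -[0](raddf0 quot_proj) /=; apply: iff_trans (quot_classP _ _) _; rewrite subr0.
Qed.

End QuotientGroup.

Section QuotientModule.
Variables (R : pzRingType) (V : lmodType R) (N : subgroup V).

Definition stable_under_scaling := forall a x, N x -> N (a *: x).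
Hypothesis N_scale : stable_under_scaling.

Definition quotmod of stable_under_scaling := quot N.
Local Notation V_N := (quotmod N_scale).
HB.instance Definition _ := GRing.Zmodule.on V_N.

Let scale (a : R) (z : V_N) : V_N := quot_class N (a *: repr (z : quot N)).

Let scaleE a x : scale a (quot_class N x) = quot_class N (a *: x).
Proof.
apply/quot_classP; rewrite -scalerBr; apply/N_scale/quot_classP.
exact: reprK.
Qed.

Let scaleA a b z : scale a (scale b z) = scale (a * b) z.
Proof. by have [x <-] := quot_classK z; rewrite !scaleE scalerA. Qed.
Let scale1 : left_id 1 scale.
Proof. by move=> z; have [x <-] := quot_classK z; rewrite scaleE scale1r. Qed.
Let scaleDr : right_distributive scale +%R.
Proof.
move=> a z t; have [[x <-] [y <-]] := (quot_classK z, quot_classK t).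
by rewrite -raddfD !scaleE -raddfD scalerDr.
Qed.
Let scaleDl z : {morph scale^~ z : a b / a + b}.
Proof.
by move=> a b; have [x <-] := quot_classK z; rewrite !scaleE scalerDl raddfD.
Qed.

HB.instance Definition _ := GRing.Zmodule_isLmodule.Build R V_N
  scaleA scale1 scaleDr scaleDl.

Fact quotmod_proj_linear : linear (quot_class N : V -> V_N).
Proof. by move=> a x y; rewrite raddfD; congr (_ + _); apply/esym/scaleE. Qed.

Definition quotmod_proj : {linear V -> V_N} := linear_of quotmod_proj_linear.

Lemma quotmod_proj_surj : surj quotmod_proj.
Proof. exact: quot_classK. Qed.

Lemma quotmod_proj_eq0 x : quotmod_proj x = 0 <-> N x.
Proof. exact: quot_proj_eq0. Qed.

End QuotientModule.

Section QuotientExistence.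
Variable R : pzRingType.
Implicit Types U V W : lmodType R.

Lemma quotient_exists V (P : V -> Prop) :
    P 0 -> (forall a x y, P x -> P y -> P (a *: x + y)) ->
  exists (W : lmodType R) (q : {linear V -> W}), surj q /\ forall x, q x = 0 <-> P x.
Proof.
move=> P0 PP.
have PB x y : P x -> P y -> P (x - y).
  by move=> Px Py; rewrite addrC -scaleN1r; apply: PP.
pose N := Subgroup P0 PB.
have PZ : stable_under_scaling N.
  by move=> a x Px; rewrite -[_ *: _]addr0; apply: PP.
exists (quotmod PZ), (quotmod_proj PZ).
by split; [apply: quotmod_proj_surj | apply: quotmod_proj_eq0].
Qed.

Lemma cokernel_exists U V (f : {linear U -> V}) :
  exists (W : lmodType R) (q : {linear V -> W}), exact_at f q /\ surj q.
Proof.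
have [|a x y [u <-] [v <-]|W [q [q_surj qP]]] := @quotient_exists V (fun x => exists u, f u = x).
- by exists 0; apply: linear0.
- by exists (a *: u + v); rewrite linearP.
- by exists W, q.
Qed.

(** [d] need not be injective: dividing by its kernel reduces to the definition. For differentials
    of a resolution this is the exactness of Hom into [E]. *)
Lemma injective_module_extend (E : lmodType R) U V (d : {linear U -> V})
    (f : {linear U -> E}) :
  injective_module E -> (forall x, d x = 0 -> f x = 0) ->
  exists g : {linear V -> E}, forall x, g (d x) = f x.
Proof.
move=> E_inj ker.
have [|a x y|W [q [q_surj qP]]] := @quotient_exists U (fun x => d x = 0).
- exact: linear0.
- by rewrite linearP => -> ->; rewrite scaler0 addr0.
have [d' d'E] : exists d' : {linear W -> V}, forall x, d' (q x) = d x.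
  by apply: factor_surj => // x /qP.
have [f' f'E] : exists f' : {linear W -> E}, forall x, f' (q x) = f x.
  by apply: factor_surj => // x /qP; apply: ker.
have d'_inj : injective d'.
  move=> w w'; have [[x <-] [y <-]] := (q_surj w, q_surj w').
  rewrite !d'E => /eqP; rewrite -subr_eq0 -linearB => /eqP/qP/eqP.
  by rewrite linearB subr_eq0 => /eqP.
have [g gE] := E_inj _ _ d' f' d'_inj.
by exists g => x; rewrite -d'E gE f'E.
Qed.

End QuotientExistence.

(** * Projective resolutions *)

(* Identifying formal sums that agree under every map from X to a module makes the
   universal property immediate. *)
Section FreeModule.
Variables (R : pzRingType) (X : Type).
Implicit Type V : lmodType R.

Definition free_sum := seq {classic (R * X)}.

Definition free_value (V : lmodType R) (g : X -> V) (w : free_sum) : V :=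
  \sum_(k <- w) (k : R * X).1 *: g (k : R * X).2.

Definition free_equiv (w w' : free_sum) : bool :=
  `[< forall (V : lmodType R) (g : X -> V), free_value g w = free_value g w' >].

Fact free_equiv_refl : reflexive free_equiv.
Proof. by move=> w; apply/asboolP. Qed.
Fact free_equiv_sym : symmetric free_equiv.
Proof. by move=> w w'; apply/asboolP/asboolP => E V g; rewrite E. Qed.
Fact free_equiv_trans : transitive free_equiv.
Proof.
by move=> w w' w'' /asboolP E /asboolP E'; apply/asboolP => V g; rewrite E.
Qed.

Canonical free_equiv_rel :=
  EquivRel free_equiv free_equiv_refl free_equiv_sym free_equiv_trans.

Definition free := {eq_quot free_equiv}.
HB.instance Definition _ := Choice.on free.
HB.instance Definition _ : EqQuotient _ free_equiv free := EqQuotient.on free.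

Definition free_class (w : free_sum) : free := \pi_free w.

Lemma free_classP w w' : free_class w = free_class w' <->
  forall (V : lmodType R) (g : X -> V), free_value g w = free_value g w'.
Proof.
split=> [/eqP|E]; first by rewrite eqmodE => /asboolP.
by apply/eqP; rewrite eqmodE; apply/asboolP.
Qed.

Definition free_lift_fun (V : lmodType R) (g : X -> V) (z : free) : V :=
  free_value g (repr z).

Lemma free_lift_class V (g : X -> V) w :
  free_lift_fun g (free_class w) = free_value g w.
Proof. by apply/(free_classP _ _).1; apply: reprK. Qed.

Lemma free_separated (z t : free) :
  (forall (V : lmodType R) (g : X -> V), free_lift_fun g z = free_lift_fun g t) ->
  z = t.
Proof.
move=> E; rewrite -[z]reprK -[t]reprK; apply/free_classP => V g; exact: E.
Qed.

Definition free_scale_gen (a : R) (k : R * X) : {classic (R * X)} := (a * k.1, k.2).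

Let zero : free := free_class [::].
Let scale (a : R) (z : free) : free := free_class (map (free_scale_gen a) (repr z)).
Let opp (z : free) : free := scale (-1) z.
Let add (z t : free) : free := free_class (repr z ++ repr t).

Let lift0 V (g : X -> V) : free_lift_fun g zero = 0.
Proof. by rewrite free_lift_class /free_value big_nil. Qed.
Let liftZ V (g : X -> V) a z : free_lift_fun g (scale a z) = a *: free_lift_fun g z.
Proof.
rewrite free_lift_class /free_value big_map scaler_sumr.
by apply: eq_bigr => k _; rewrite scalerA.
Qed.
Let liftN V (g : X -> V) z : free_lift_fun g (opp z) = - free_lift_fun g z.
Proof. by rewrite liftZ scaleN1r. Qed.
Let liftD V (g : X -> V) z t :
  free_lift_fun g (add z t) = free_lift_fun g z + free_lift_fun g t.
Proof. by rewrite free_lift_class /free_value big_cat. Qed.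

Let addA : associative add.
Proof. by move=> t u v; apply: free_separated => V g; rewrite !liftD addrA. Qed.
Let addC : commutative add.
Proof. by move=> t u; apply: free_separated => V g; rewrite !liftD addrC. Qed.
Let add0 : left_id zero add.
Proof. by move=> t; apply: free_separated => V g; rewrite liftD lift0 add0r. Qed.
Let addN : left_inverse zero opp add.
Proof. by move=> t; apply: free_separated => V g; rewrite liftD liftN lift0 addNr. Qed.

HB.instance Definition _ := GRing.isZmodule.Build free addA addC add0 addN.

Let scaleA a b z : scale a (scale b z) = scale (a * b) z.
Proof. by apply: free_separated => V g; rewrite !liftZ scalerA. Qed.
Let scale1 : left_id 1 scale.
Proof. by move=> z; apply: free_separated => V g; rewrite liftZ scale1r. Qed.
Let scaleDr : right_distributive scale +%R.
Proof.
by move=> a z t; apply: free_separated => V g; rewrite liftZ !liftD !liftZ scalerDr.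
Qed.
Let scaleDl z : {morph scale^~ z : a b / a + b}.
Proof.
by move=> a b; apply: free_separated => V g; rewrite liftZ liftD !liftZ scalerDl.
Qed.

HB.instance Definition _ := GRing.Zmodule_isLmodule.Build R free
  scaleA scale1 scaleDr scaleDl.

Fact free_lift_linear V (g : X -> V) : linear (free_lift_fun g).
Proof. by move=> a z t; rewrite liftD liftZ. Qed.

Definition free_lift V (g : X -> V) : {linear free -> V} :=
  linear_of (free_lift_linear g).

Definition free_gen (x : X) : free := free_class [:: (1, x) : {classic (R * X)}].

Lemma free_liftE V (g : X -> V) x : free_lift g (free_gen x) = g x.
Proof.
by apply: etrans (free_lift_class _ _) _; rewrite /free_value big_seq1 scale1r.
Qed.

Lemma free_ext V (f g : {linear free -> V}) :
  (forall x, f (free_gen x) = g (free_gen x)) -> forall z, f z = g z.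
Proof.
move=> fg z; rewrite -[z]reprK; elim: (repr z) => [|[a x] w IH].
  by rewrite (_ : \pi_free [::] = 0) ?linear0.
have -> : \pi_free ((a, x) :: w : free_sum) = a *: free_gen x + \pi_free w.
  apply: free_separated => W h.
  rewrite [RHS]liftD liftZ !free_lift_class.
  by rewrite /free_value big_cons big_seq1 scale1r.
by rewrite !linearP fg IH.
Qed.

Lemma free_projective : projective_module free.
Proof.
move=> U V f g f_surj; have [h hE] := choice (fun x => f_surj (g (free_gen x))).
exists (free_lift h) => z.
apply: (free_ext (f := f \o free_lift h)) => x.
by rewrite -hE -(free_liftE h).
Qed.

End FreeModule.

Section ProjectiveResolutionExists.
Variables (R : pzRingType) (M : lmodType R).

Definition free_cover (V : lmodType R) : {linear free R V -> V} := free_lift id.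

Lemma free_cover_surj V : surj (free_cover V).
Proof. by move=> x; exists (free_gen R x); rewrite free_liftE. Qed.

Fixpoint syzygy n : lmodType R :=
  if n is m.+1 then kernel (free_cover (syzygy m)) else M.

Definition syzygy_d n : {linear free R (syzygy n.+1) -> free R (syzygy n)} :=
  kernel_incl _ \o free_cover (syzygy n.+1).

(** With [g] left open the lemma serves both the augmentation and the next differential, whose
    kernels agree with that of the free cover. *)
Lemma syzygy_d_exact (A : lmodType R) n (g : {linear free R (syzygy n) -> A}) :
  (forall x, g x = 0 <-> free_cover (syzygy n) x = 0) -> exact_at (syzygy_d n) g.
Proof.
move=> gE x; apply: iff_trans (gE x) _.
split=> [/kernel_incl_exact[y <-]|[y <-]].
  by have [z <-] := free_cover_surj y; exists z.
by apply/kernel_incl_exact; exists (free_cover _ y).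
Qed.

(** [Ext_zero] quantifies over all resolutions, so it can be applied as a hypothesis only once one
    of them exists. *)
Lemma projective_resolution_exists : inhabited (projective_resolution M).
Proof.
split; apply: (@ProjectiveResolution _ _ (fun n => free R (syzygy n)) syzygy_d
  (free_cover M)).
- by move=> n; apply: free_projective.
- exact: free_cover_surj.
- exact: syzygy_d_exact.
- by move=> n; apply: syzygy_d_exact => x; exact: injective_eq0 (@kernel_incl_inj _ _ _ _) _.
Qed.

End ProjectiveResolutionExists.

(** * Enough injective modules *)

Section DivisibleExtension.
Variables (B D : zmodType).
Local Open Scope classical_set_scope.

Definition divisible_group := forall d, (0 < d)%N -> forall z : D, exists y, y *+ d = z.

(** The graph of a homomorphism to [D] from a subgroup of [B]. As a set of pairs it is ordered by
    inclusion, which is the form that Zorn's lemma takes below. *)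
Definition partial_hom (A : set (B * D)) :=
  [/\ A 0, forall p q, A p -> A q -> A (p - q) & forall w, A (0, w) -> w = 0].

Lemma partial_homN A p : partial_hom A -> A p -> A (- p).
Proof. by case=> A0 AB _ Ap; rewrite -sub0r; apply: AB. Qed.

Lemma partial_homD A p q : partial_hom A -> A p -> A q -> A (p + q).
Proof.
move=> hA Ap Aq; rewrite -[q]opprK.
by case: (hA) => _ AB _; apply: AB => //; apply: partial_homN.
Qed.

Lemma partial_homMz A p n : partial_hom A -> A p -> A (p *~ n).
Proof.
move=> hA Ap; have ApM m : A (p *+ m).
  elim: m => [|m IH]; first by rewrite mulr0n; case: hA.
  by rewrite mulrS; apply: partial_homD.
by case: n => m; [apply: ApM | apply: partial_homN hA (ApM m.+1)].
Qed.

Lemma partial_hom_fun A b y z : partial_hom A -> A (b, y) -> A (b, z) -> y = z.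
Proof.
move=> [_ AB A0] Ay Az; apply/eqP; rewrite -subr_eq0; apply/eqP/A0.
by rewrite -(subrr b); apply: (AB (b, y) (b, z)).
Qed.

Lemma pairMz (b : B) (y : D) n : (b, y) *~ n = (b *~ n, y *~ n).
Proof.
have pairMn m : (b, y) *+ m = (b *+ m, y *+ m).
  by elim: m => [|m IH]; rewrite ?mulr0n // !mulrS IH.
by case: n => m; rewrite /intmul ?pairMn.
Qed.

Definition adjoin (A : set (B * D)) p : set (B * D) := fun q => exists n, A (q - p *~ n).

Lemma adjoin_partial_hom A b y : partial_hom A ->
  (forall n z, A (b *~ n, z) -> z = y *~ n) -> partial_hom (adjoin A (b, y)).
Proof.
move=> hA compat; split.
- by exists 0; rewrite mulr0z subr0; case: hA.
- move=> p q [n An] [m Am]; exists (n - m).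
  have -> : p - q - (b, y) *~ (n - m) = (p - (b, y) *~ n) - (q - (b, y) *~ m).
    by rewrite mulrzBr !opprB (AC (2*2) (1*4*(3*2))).
  by case: (hA) => _ AB _; apply: AB.
- move=> w [n]; rewrite pairMz => An.
  have := compat (- n) (w - y *~ n); rewrite mulrNz -[- (b *~ n)]sub0r => /(_ An).
  by rewrite mulrNz => /eqP; rewrite subr_eq addNr => /eqP.
Qed.

Lemma sub_adjoin A p : A `<=` adjoin A p.
Proof. by move=> q Aq; exists 0; rewrite mulr0z subr0. Qed.

Lemma mem_adjoin A p : A 0 -> adjoin A p p.
Proof. by move=> A0; exists 1; rewrite mulr1z subrr. Qed.

(** The integers n with n b in the domain form a subgroup of the integers. If it is zero, any y is
    compatible; otherwise its least positive element d decides, and division with remainder by d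
    settles the other multiples. The predicate [P] allows the same argument to deliver a nonzero
    y. *)
Lemma partial_hom_period A b (P : D -> Prop) : partial_hom A ->
    (forall d, (0 < d)%N -> (exists z, A (b *+ d, z)) ->
       (forall d', (0 < d' < d)%N -> ~ exists z, A (b *+ d', z)) ->
     exists2 y, P y & A (b *+ d, y *+ d)) ->
    (exists y, P y) ->
  exists2 y, P y & forall n z, A (b *~ n, z) -> z = y *~ n.
Proof.
move=> hA ex_y [y0 Py0].
have [[d0 d0P]|none] := pselect (exists d, `[< (0 < d)%N /\ exists z, A (b *+ d, z) >]); last first.
  exists y0 => // n z Az.
  have dom m t : A (b *+ m, t) -> m = 0%N.
    case: m => // m At; case: none; exists m.+1; apply/asboolP; split=> //.
    by exists t.
  case: n Az => m Az.
    have m0 := dom _ _ Az; subst m.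
    by case: hA => _ _ inj; apply: inj Az.
  have /dom // : A (b *+ m.+1, - z).
  by rewrite -[b *+ _]opprK; exact: partial_homN hA Az.
have /ex_minnP[d /asboolP[d_gt0 dP] d_min] : exists d, `[< (0 < d)%N /\ exists z, A (b *+ d, z) >].
  by exists d0.
have [|y Py Ay] := ex_y d d_gt0 dP.
  move=> d' /andP[d'_gt0 lt_d'd] ex_z.
  suff /d_min : `[< (0 < d')%N /\ exists z, A (b *+ d', z) >] by rewrite leqNgt lt_d'd.
  exact/asboolP.
exists y => // n z Az.
have key m t : A (b *+ m, t) -> t = y *+ m.
  move=> At; have m_eq := divn_eq m d.
  have Ar : A (b *+ (m %% d), t - y *+ (m %/ d * d)).
    have := partial_homMz (- (m %/ d)%N%:Z) hA Ay.
    rewrite pairMz => /(partial_homD hA At).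
    rewrite !mulrNz -!pmulrn -!mulrnA ![(d * _)%N]mulnC.
    congr (A (_, _)).
    by rewrite {1}m_eq mulrnDr addrAC subrr add0r.
  have r0 : (m %% d = 0)%N.
    apply/eqP; rewrite -leqn0 leqNgt; apply/negP => r_gt0.
    suff /d_min : `[< (0 < m %% d)%N /\ exists z, A (b *+ (m %% d), z) >].
      by rewrite leqNgt ltn_mod d_gt0.
    by apply/asboolP; split=> //; exists (t - y *+ (m %/ d * d)).
  move: Ar; rewrite r0 mulr0n => Ar; case: (hA) => _ _ /(_ _ Ar)/eqP.
  by rewrite subr_eq0 [in RHS]m_eq r0 addn0 => /eqP.
case: n Az => m Az; first exact: key.
apply: oppr_inj; rewrite [in RHS]/intmul opprK; apply: key.
by rewrite -[b *+ _]opprK; exact: partial_homN hA Az.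
Qed.

Hypothesis D_div : divisible_group.

Lemma partial_hom_extend A : partial_hom A ->
  exists h : {additive B -> D}, forall b y, A (b, y) -> h b = y.
Proof.
move=> hA.
(* The sets being ordered are those adjoined to [A]: the empty chain then gives [A] itself, and the
   maximal graph contains [A]. *)
have [F|M [hM maxM]] := @Zorn_bigcup (B * D)%type (fun M => partial_hom (A `|` M)).
  move=> FP F_tot; split=> [|p q|w].
  - by left; case: hA.
  - have AFB X p' q' : F X -> (A `|` X) p' -> (A `|` X) q' ->
      (A `|` \bigcup_(X in F) X) (p' - q').
      move=> FX Ap' Aq'; have [_ AB _] := FP _ FX; case: (AB _ _ Ap' Aq'); first by left.
      by right; exists X.
    case=> [Ap|[X FX Xp]] [Aq|[Y FY Yq]].
    + by left; case: hA => _ AB _; apply: AB.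
    + by apply: (AFB Y) => //; [left | right].
    + by apply: (AFB X) => //; [right | left].
    + case: (F_tot _ _ FX FY) => sub.
      * by apply: (AFB Y) => //; right=> //; apply: sub.
      * by apply: (AFB X) => //; right=> //; apply: sub.
  - case=> [Aw|[X FX Xw]]; first by case: hA => _ _; apply.
    by have [_ _] := FP _ FX; apply; right.
pose G := A `|` M.
have tot b : exists y, G (b, y).
  have [||y _ compat] := @partial_hom_period G b (fun _ => True) hM.
  - move=> d d_gt0 [z Gz] _; have [y yd] := D_div d_gt0 z.
    by exists y; rewrite ?yd.
  - by exists 0.
  have hG' := adjoin_partial_hom hM compat.
  have subG : A `|` adjoin G (b, y) = adjoin G (b, y).
    by apply/setUidPr => p Ap; apply: sub_adjoin; left.
  exists y; apply: contrapT => nG.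
  apply: (maxM (adjoin G (b, y))); last by rewrite subG.
  split=> [p Mp|]; first by apply: sub_adjoin; right.
  move=> sub; apply: nG; right; apply: sub; apply: mem_adjoin.
  by case: hM.
have [h hP] := choice tot.
have h_add : zmod_morphism h.
  move=> x y; apply: (partial_hom_fun (b := x - y) hM); first exact: hP.
  by case: (hM) => _ GB _; apply: (GB _ _ (hP x) (hP y)).
pose hA' := GRing.isZmodMorphism.Build _ _ h h_add.
pose h' : {additive B -> D} := HB.pack h hA'.
exists h' => b y Ay; apply: (partial_hom_fun (b := b) hM); first exact: hP.
by left.
Qed.

End DivisibleExtension.

Definition integral_rat (x : rat) : Prop := exists n : int, x = n%:~R.

Fact integral_rat0 : integral_rat 0.
Proof. by exists 0. Qed.

Fact integral_ratB x y : integral_rat x -> integral_rat y -> integral_rat (x - y).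
Proof. by move=> [m ->] [n ->]; exists (m - n); rewrite rmorphB. Qed.

Definition rat_mod_int := quot (Subgroup integral_rat0 integral_ratB).

Lemma rat_mod_int_divisible : divisible_group rat_mod_int.
Proof.
move=> d d_gt0 z; have [x <-] := quot_proj_surj z.
exists (quot_proj _ (x / d%:R)).
by rewrite -raddfMn -[_ *+ d]mulr_natr divfK // pnatr_eq0 -lt0n.
Qed.

Lemma rat_mod_int_torsion d : (1 < d)%N ->
  exists2 y : rat_mod_int, y != 0 & y *+ d = 0.
Proof.
move=> d_gt1; have d_neq0 : d%:R != 0 :> rat by rewrite pnatr_eq0 -lt0n ltnW.
exists (quot_proj _ d%:R^-1).
  apply/eqP => /quot_proj_eq0[n nE].
  have /eqP : (n * d%:Z)%:~R = 1 :> rat by rewrite intrM -nE mulVf.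
  rewrite (eqr_int _ _ 1) => /eqP/(congr1 absz); rewrite abszM /= => /eqP.
  by rewrite muln_eq1 => /andP[_ /eqP d1]; move: d_gt1; rewrite d1.
rewrite -raddfMn -[_ *+ d]mulr_natr mulVf //.
by apply/quot_proj_eq0; exists 1.
Qed.

(** An element of order d goes to the class of 1/d, one of infinite order to the class of 1/2;
    divisibility extends this from the cyclic subgroup to [M]. *)
Lemma rat_mod_int_separates (M : zmodType) (m : M) : m != 0 ->
  exists h : {additive M -> rat_mod_int}, h m != 0.
Proof.
move=> m_neq0; pose A : set (M * rat_mod_int) := [set 0]%classic.
have hA : partial_hom A.
  split=> // [p q -> ->|w [->]] //; exact: subrr.
have [||y y_neq0 yP] := @partial_hom_period _ _ A m (fun y => y != 0) hA.
- move=> d d_gt0 [z [md0 z0]] _.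
  have [|y y_neq0 yd] := @rat_mod_int_torsion d.
    rewrite ltn_neqAle d_gt0 andbT; apply: contra_neq m_neq0 => d1.
    by rewrite -md0 -d1.
  by exists y => //; rewrite md0 yd.
- by have [y y0 _] := @rat_mod_int_torsion 2 isT; exists y.
have hA' := adjoin_partial_hom hA yP.
have [h hP] := partial_hom_extend rat_mod_int_divisible hA'.
by exists h; rewrite (hP m y) //; apply: mem_adjoin.
Qed.

Section Coinduced.
Variables (R : pzRingType) (D : zmodType).

Definition coinduced := {additive R -> D}.
Implicit Types f g h : coinduced.

Lemma coinduced_ext f g :
  (forall x, (f : {additive _ -> _}) x = (g : {additive _ -> _}) x) -> f = g.
Proof. exact: (@homZ_ext R R^o D). Qed.

HB.instance Definition _ := gen_eqMixin coinduced.
HB.instance Definition _ := gen_choiceMixin coinduced.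

Let add f g : coinduced := (f : {additive _ -> _}) \+ (g : {additive _ -> _}).
Let opp f : coinduced := \- (f : {additive _ -> _}).
Let zero : coinduced := (\0 : R -> D).

Let addA : associative add.
Proof. by move=> f g h; apply: coinduced_ext => x /=; rewrite addrA. Qed.
Let addC : commutative add.
Proof. by move=> f g; apply: coinduced_ext => x /=; rewrite addrC. Qed.
Let add0 : left_id zero add.
Proof. by move=> f; apply: coinduced_ext => x /=; rewrite add0r. Qed.
Let addN : left_inverse zero opp add.
Proof. by move=> f; apply: coinduced_ext => x /=; rewrite addNr. Qed.

HB.instance Definition _ := GRing.isZmodule.Build coinduced addA addC add0 addN.

Fact coinduced_scale_zmod_morphism a f :
  zmod_morphism (fun r => (f : {additive _ -> _}) (r * a)).
Proof. by move=> r s; rewrite mulrBl raddfB. Qed.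

Let scale (a : R) f : coinduced := HB.pack (fun r => (f : {additive _ -> _}) (r * a))
  (GRing.isZmodMorphism.Build R D _ (coinduced_scale_zmod_morphism a f)).
Let scaleA a b f : scale a (scale b f) = scale (a * b) f.
Proof. by apply: coinduced_ext => x /=; rewrite mulrA. Qed.
Let scale1 : left_id 1 scale.
Proof. by move=> f; apply: coinduced_ext => x /=; rewrite mulr1. Qed.
Let scaleDr : right_distributive scale +%R.
Proof. by move=> a f g; apply: coinduced_ext. Qed.
Let scaleDl f : {morph scale^~ f : a b / a + b}.
Proof. by move=> a b; apply: coinduced_ext => x /=; rewrite mulrDr raddfD. Qed.

HB.instance Definition _ := GRing.Zmodule_isLmodule.Build R coinduced
  scaleA scale1 scaleDr scaleDl.

Section Transpose.
Variables (V : lmodType R) (h : {additive V -> D}).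

Fact transpose_at_zmod_morphism v : zmod_morphism (fun r : R => h (r *: v)).
Proof. by move=> r s; rewrite scalerBl raddfB. Qed.

Definition transpose_at v : coinduced :=
  HB.pack (fun r : R => h (r *: v))
    (GRing.isZmodMorphism.Build R D (fun r : R => h (r *: v)) (transpose_at_zmod_morphism v)).

Fact transpose_linear : linear transpose_at.
Proof.
move=> a u v; apply: coinduced_ext => r /=.
by rewrite scalerDr raddfD scalerA.
Qed.

Definition transpose : {linear V -> coinduced} := linear_of transpose_linear.

End Transpose.

(** By adjunction a linear map to [coinduced] amounts to the additive map obtained by evaluating at
    1, and additive maps to a divisible group extend; [transpose] is the way back. *)
Lemma coinduced_injective : divisible_group D -> injective_module coinduced.
Proof.
move=> D_div U V f g f_inj.
pose A : set (V * D) := fun p => exists2 u, f u = p.1 & (g u : {additive _ -> _}) 1 = p.2.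
have hA : partial_hom A.
  split.
  - by exists 0; rewrite ?linear0.
  - move=> [v x] [v' x'] [u /= <- <-] [u' /= <- <-].
    by exists (u - u'); rewrite linearB.
  - by move=> w [u /= /injective_eq0 -/(_ f_inj) -> <-]; rewrite linear0.
have [h hP] := partial_hom_extend D_div hA.
exists (transpose h) => u; apply: coinduced_ext => r /=.
rewrite -linearZ; rewrite (hP _ ((g (r *: u) : {additive _ -> _}) 1)); last by exists (r *: u).
by rewrite linearZ /= mul1r.
Qed.

End Coinduced.

Section Products.
Variables (R : pzRingType) (I : Type).
Implicit Type M : I -> lmodType R.

Section Maps.
Variables (M : I -> lmodType R) (L : lmodType R).

Fact prod_proj_linear i : linear (fun x : prodmod M => x i).
Proof. by []. Qed.
Definition prod_proj i : {linear prodmod M -> M i} := linear_of (@prod_proj_linear i).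

Variable f : forall i, {linear L -> M i}.
Fact prod_pair_linear : linear (fun x : L => (fun i => f i x) : prodmod M).
Proof. by move=> a x y; apply: functional_extensionality_dep => i; apply: linearP. Qed.
Definition prod_pair : {linear L -> prodmod M} := linear_of prod_pair_linear.
End Maps.

Lemma prod_injective_module M :
  (forall i, injective_module (M i)) -> injective_module (prodmod M).
Proof.
move=> M_inj U V f g f_inj.
have [h hE] := dep_choice (fun i => M_inj i _ _ f (prod_proj M i \o g) f_inj).
by exists (prod_pair h) => x; apply: functional_extensionality_dep => i; apply: hE.
Qed.

End Products.

(** There is one factor for each additive map h from [M] to the rationals modulo the integers.
    Evaluating that coordinate at 1 returns h, and these maps separate points. *)
Lemma enough_injective_modules (R : pzRingType) (M : lmodType R) :
  exists2 E : lmodType R, injective_module E &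
    exists e : {linear M -> E}, injective e.
Proof.
exists (prodmod (fun h : {additive M -> rat_mod_int} => coinduced R rat_mod_int)).
  by apply: prod_injective_module => _; apply/coinduced_injective/rat_mod_int_divisible.
exists (prod_pair (fun h : {additive M -> rat_mod_int} => transpose h)) => x y exy.
apply: contrapT => /eqP; rewrite -subr_eq0 => /rat_mod_int_separates[h].
have /(congr1 (fun f => (f : {additive _ -> _}) 1)) := congr1 (fun z => z h) exy.
by rewrite /= !scale1r raddfB => ->; rewrite subrr eqxx.
Qed.

(** * Strongly fp-injective modules *)

Section ExtVanishing.
Variable R : pzRingType.
Implicit Types L M P E Z : lmodType R.

Lemma exact_comp0 (A B C : zmodType) (f : A -> B) (g : B -> C) :
  exact_at f g -> forall x, g (f x) = 0.
Proof. by move=> ex x; apply/ex; exists x. Qed.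

Lemma injective_module_sfp E : injective_module E -> strongly_fp_injective_module E.
Proof.
move=> E_inj M _ [//|n] _ P f f0.
have [|g gE] := injective_module_extend (d := pres_d P n) (f := f) E_inj.
  by move=> x /(@pres_exact _ _ P n)[y <-].
by exists g.
Qed.

Lemma prod_sfp_module (I : Type) (M : I -> lmodType R) :
  (forall i, strongly_fp_injective_module (M i)) ->
  strongly_fp_injective_module (prodmod M).
Proof.
move=> sfp P fpP [//|n] _ pP f f0.
have ex i : exists g : {linear pP n -> M i}, forall x, f x i = g (pres_d pP n x).
  have := sfp i P fpP n.+1 isT pP (prod_proj M i \o f).
  by apply=> x /=; rewrite f0.
have [g gE] := dep_choice ex.
by exists (prod_pair g) => x; apply: functional_extensionality_dep => i; apply: gE.
Qed.

(** Purity of an epimorphism of modules, in a form without tensor products. *)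
Definition fp_lifting (A B : lmodType R) (q : {linear A -> B}) : Prop :=
  forall P : lmodType R, finitely_presented P ->
    forall u : {linear P -> B}, exists v : {linear P -> A}, forall x, q (v x) = u x.

Section ShortExact.
Variables (L E Z : lmodType R) (e : {linear L -> E}) (q : {linear E -> Z}).
Hypotheses (e_inj : injective e) (eq_exact : exact_at e q) (q_surj : surj q).

Lemma sub_through (U : lmodType R) (g : {linear U -> E}) :
  (forall x, q (g x) = 0) -> exists f : {linear U -> L}, forall x, e (f x) = g x.
Proof. by move=> qg; apply: lift_inj => // x; apply/eq_exact/qg. Qed.

(** The obstruction to lifting [u] lies in Ext^1(P, L): a lift on the degree 0 term of a resolution
    leaves a 1-cocycle, and subtracting a cochain that bounds it makes the lift descend to P. *)
Lemma sfp_fp_lifting : strongly_fp_injective_module L -> fp_lifting q.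
Proof.
move=> sfp P fpP u; have [p] := projective_resolution_exists P.
have [g gE] := @pres_projective _ _ p 0 _ _ q (u \o pres_aug p) q_surj.
have [|f fE] := @sub_through _ (g \o pres_d p 0).
  by move=> x; rewrite /= gE /= (exact_comp0 (@pres_exact0 _ _ p)) linear0.
have [|k kE] := sfp P fpP 1 isT p f.
  move=> x; apply/(injective_eq0 e_inj).
  by rewrite fE /= (exact_comp0 (@pres_exact _ _ p 0)) linear0.
have [|h hE] := @factor_surj _ _ _ _ (pres_aug p) (g \- (e \o k)) (pres_surj p).
  by move=> x /(@pres_exact0 _ _ p)[y <-] /=; rewrite -kE fE /= subrr.
exists h => x; have [y <-] := pres_surj p x.
by rewrite hE /= linearB gE /= (exact_comp0 eq_exact) subr0.
Qed.

(** Dimension shift: as [E] is injective, Ext^n(P, Z) is Ext^(n+1)(P, L) for n at least 1. *)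
Lemma sfp_cokernel : injective_module E -> strongly_fp_injective_module L ->
  strongly_fp_injective_module Z.
Proof.
move=> E_inj sfp P fpP [//|n] _ p f f0.
have [g gE] := @pres_projective _ _ p n.+1 _ _ q f q_surj.
have [|f' f'E] := @sub_through _ (g \o pres_d p n.+1).
  by move=> x; rewrite /= gE f0.
have [|k kE] := sfp P fpP n.+2 isT p f'.
  move=> x; apply/(injective_eq0 e_inj).
  by rewrite f'E /= (exact_comp0 (@pres_exact _ _ p _)) linear0.
have [|h hE] := injective_module_extend (d := pres_d p n) (f := g \- (e \o k)) E_inj.
  by move=> x /(@pres_exact _ _ p n)[y <-] /=; rewrite -kE f'E /= subrr.
exists (q \o h) => x.
by rewrite /= hE /= linearB gE (exact_comp0 eq_exact) subr0.
Qed.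

Lemma Ext1_zero_of_fp_lifting : injective_module E -> fp_lifting q ->
  forall P, finitely_presented P -> Ext_zero 1 P L.
Proof.
move=> E_inj lift P fpP p f f0.
have [|g gE] := injective_module_extend (d := pres_d p 0) (f := e \o f) E_inj.
  by move=> x /(@pres_exact _ _ p 0)[y <-] /=; rewrite f0 linear0.
have [|u uE] := @factor_surj _ _ _ _ (pres_aug p) (q \o g) (pres_surj p).
  by move=> x /(@pres_exact0 _ _ p)[y <-] /=; rewrite gE /= (exact_comp0 eq_exact).
have [v vE] := lift P fpP u.
have [|k kE] := @sub_through _ (g \- (v \o pres_aug p)).
  by move=> x /=; rewrite linearB /= vE uE /= subrr.
exists k => x; apply: e_inj.
by rewrite kE /= gE /= (exact_comp0 (@pres_exact0 _ _ p)) linear0 subr0.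
Qed.

Lemma Ext_zero_shift n P : injective_module E ->
  Ext_zero n.+1 P Z -> Ext_zero n.+2 P L.
Proof.
move=> E_inj ExtZ p f f0.
have [|g gE] := injective_module_extend (d := pres_d p n.+1) (f := e \o f) E_inj.
  by move=> x /(@pres_exact _ _ p n.+1)[y <-] /=; rewrite f0 linear0.
have [|u uE] := ExtZ p (q \o g).
  by move=> x /=; rewrite gE /= (exact_comp0 eq_exact).
have [v vE] := @pres_projective _ _ p n _ _ q u q_surj.
have [|k kE] := @sub_through _ (g \- (v \o pres_d p n)).
  by move=> x /=; rewrite linearB /= vE -uE /= subrr.
exists k => x; apply: e_inj.
by rewrite kE /= gE /= (exact_comp0 (@pres_exact _ _ p n)) linear0 subr0.
Qed.

End ShortExact.

(** Induction on n with the coresolution generalised. Ext^1 vanishes because [d 0], as a map onto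
    its image, lifts maps from finitely presented modules; higher Ext shifts to the cosyzygy
    [kernel (d 1)], which has the truncated coresolution. *)
Lemma sfp_of_coresolution (E : nat -> lmodType R) (d : forall n, {linear E n -> E n.+1})
    (L : lmodType R) (e : {linear L -> E 0}) :
    (forall n, injective_module (E n)) -> injective e -> exact_at e (d 0) ->
    (forall n, exact_at (d n) (d n.+1)) ->
    (forall P, finitely_presented P -> forall n (u : {linear P -> E n.+1}),
       (forall x, d n.+1 (u x) = 0) ->
       exists v : {linear P -> E n}, forall x, d n (v x) = u x) ->
  strongly_fp_injective_module L.
Proof.
move=> E_inj e_inj e_exact d_exact lift P fpP n.
elim: n E d L e E_inj e_inj e_exact d_exact lift =>
  [//|n IH] E d L e E_inj e_inj e_exact d_exact lift _.
have [|q qE] := @lift_inj _ _ _ _ (kernel_incl (d 1)) (d 0) (@kernel_incl_inj _ _ _ _).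
  by move=> x; apply/kernel_incl_exact/d_exact; exists x.
have q_surj : surj q.
  move=> z; have /d_exact[x xE] : d 1 (kernel_incl (d 1) z) = 0.
    by apply/kernel_incl_exact; exists z.
  by exists x; apply: (@kernel_incl_inj _ _ _ (d 1)); rewrite qE.
have eq_exact : exact_at e q.
  move=> x; apply: iff_trans (e_exact x); rewrite -qE.
  by apply: iff_sym; apply: injective_eq0 (@kernel_incl_inj _ _ _ _) _.
case: n => [|n] in IH *.
  apply: (Ext1_zero_of_fp_lifting e_inj eq_exact) => // P' fpP' u.
  have [|v vE] := lift P' fpP' 0%N (kernel_incl _ \o u).
    by move=> x; apply/kernel_incl_exact; exists (u x).
  by exists v => x; apply: (@kernel_incl_inj _ _ _ (d 1)); rewrite qE vE.
apply: (Ext_zero_shift e_inj eq_exact q_surj) => //.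
apply: (IH (fun n => E n.+1) (fun n => d n.+1) _ (kernel_incl (d 1))) => //.
- exact: kernel_incl_exact.
- by move=> P' fpP' m; apply: lift.
Qed.

Lemma sfp_coresolution_step L : strongly_fp_injective_module L ->
  exists (E Z : lmodType R) (e : {linear L -> E}) (q : {linear E -> Z}),
    [/\ injective_module E, strongly_fp_injective_module Z, fp_lifting q
      & [/\ injective e, exact_at e q & surj q]].
Proof.
move=> sfp; have [E E_inj [e e_inj]] := enough_injective_modules L.
have [Z [q [ex q_surj]]] := cokernel_exists e.
exists E, Z, e, q; split=> //.
- exact: (sfp_cokernel e_inj ex q_surj).
- exact: (sfp_fp_lifting e_inj ex q_surj).
Qed.

End ExtVanishing.

(** * Approximate retractions *)

Section FiniteRetraction.
Variables (R : pzRingType) (A B Z : lmodType R).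
Variables (f : {linear A -> B}) (q : {linear B -> Z}).

Definition retraction_condition := (A + R * B * B)%type.

Definition satisfies (r : B -> A) (k : retraction_condition) : Prop :=
  match k with
  | inl a => r (f a) = a
  | inr (c, b, b') => r (c *: b + b') = c *: r b + r b'
  end.

Hypotheses (f_inj : injective f) (fq_exact : exact_at f q) (q_lift : fp_lifting q).

(* The finitely many elements of B involved, modulo the relations to be
   respected, present a module P -> Z; subtracting a lift P -> B corrects these
   elements into A. *)
Lemma finite_retraction (l : seq {classic retraction_condition}) :
  exists r : B -> A, forall k, k \in l -> satisfies r k.
Proof.
pose elts (k : {classic retraction_condition}) : seq B :=
  match (k : retraction_condition) with
  | inl a => [:: f a]
  | inr (c, b, b') => [:: c *: b + b'; b; b']
  end.
pose s := flatten (map elts l).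
pose delta b : 'rV[R]_(size s) := \row_k (index b s == k)%:R.
(* Elements f a vanish in [Z], so their generators may be set to 0 in P; the correction at f a is
   then 0. *)
pose rel (k : {classic retraction_condition}) : 'rV[R]_(size s) :=
  match (k : retraction_condition) with
  | inl a => delta (f a)
  | inr (c, b, b') => delta (c *: b + b') - (c *: delta b + delta b')
  end.
pose M : 'M[R]_(size l, size s) := \matrix_(i < size l) rel (nth (inl 0) l i).
have [P [g [Mg_exact g_surj]]] := cokernel_exists (mulmxr M : {linear 'rV[R]_(size l) -> _}).
have P_fp : finitely_presented P.
  by exists (size l), (size s), (mulmxr M), g.
have g_rel k : k \in l -> g (rel k) = 0.
  move=> kl; apply/Mg_exact; have lt_kl : (index k l < size l)%N by rewrite index_mem.
  exists (delta_mx 0 (Ordinal lt_kl)).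
  by rewrite /= -rowE rowK /= (nth_index _ kl).
have w_lin : linear (fun v : 'rV[R]_(size s) => \sum_k v 0 k *: q s`_k).
  move=> c v v'; rewrite scaler_sumr -big_split /=; apply: eq_bigr => k _.
  by rewrite !mxE scalerDl scalerA.
pose w := linear_of w_lin.
have w_delta b : b \in s -> w (delta b) = q b.
  move=> bs; have ltbs : (index b s < size s)%N by rewrite index_mem.
  rewrite /= /linear_of_fun (bigD1 (Ordinal ltbs)) //= mxE eqxx scale1r nth_index //.
  rewrite big1 ?addr0 // => k; rewrite mxE -val_eqE /= eq_sym.
  by case: eqP => // _ _; rewrite scale0r.
have s_elts k b : k \in l -> b \in elts k -> b \in s.
  by move=> kl bk; apply/flattenP; exists (elts k) => //; apply: map_f.
have s_lin c b b' : (inr (c, b, b') : {classic retraction_condition}) \in l ->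
    [/\ c *: b + b' \in s, b \in s & b' \in s].
  by move=> kl; split; apply: (s_elts _ _ kl); rewrite /= !inE eqxx ?orbT.
have w_rel k : k \in l -> w (rel k) = 0.
  case: k => [a|[[c b] b']] kl.
    rewrite w_delta; first by rewrite (exact_comp0 fq_exact).
    by apply: (s_elts _ _ kl); rewrite /= inE.
  have [s1 s2 s3] := s_lin _ _ _ kl.
  by rewrite linearB linearP !w_delta // linearP subrr.
have [|u uE] := @factor_surj _ _ _ _ g w g_surj.
  move=> v /Mg_exact[x <-]; rewrite /= mulmx_sum_row linear_sum big1 // => i _.
  by rewrite linearZ_LR rowK (w_rel _ (mem_nth _ (ltn_ord i))); apply: scaler0.
have [v vE] := q_lift P_fp u.
(* Subtracting the lift moves b into the image of [f]. No condition involves elements outside [s],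
   where the value 0 is arbitrary. *)
have r_ex b : exists a, b \in s -> f a = b - v (g (delta b)).
  have [bs|_] := boolP (b \in s); last by exists 0.
  have /fq_exact[a aE] : q (b - v (g (delta b))) = 0.
    by rewrite linearB vE uE w_delta // subrr.
  by exists a.
have [r rE] := choice r_ex.
exists r => -[a|[[c b] b']] kl /=; apply: f_inj.
  rewrite rE; first by have /= -> := g_rel _ kl; rewrite linear0 subr0.
  by apply: (s_elts _ _ kl); rewrite /= inE.
have [s1 s2 s3] := s_lin _ _ _ kl; rewrite linearP !rE //.
have /eqP := g_rel _ kl; rewrite /= linearB subr_eq0 linearP => /eqP ->.
by rewrite linearP scalerBr opprD addrACA.
Qed.

End FiniteRetraction.

Section ApproximateRetraction.
Variable R : pzRingType.

(** Modulo [F] this is a linear retraction of B j to a reduced power of A j: each [r l] is a mere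
    function, and each equation holds eventually, with its own member of the filter. All j share one
    index set, so that the equations at several vertices can be intersected. *)
Definition approx_retraction (J : Type) (A B : J -> lmodType R)
    (f : forall j, {linear A j -> B j}) (L : Type) (F : set_system L)
    (r : L -> forall j, B j -> A j) : Prop :=
  (forall j a, \forall l \near F, r l j (f j a) = a) /\
  (forall j c b b', \forall l \near F, r l j (c *: b + b') = c *: r l j b + r l j b').

(** An index is a family of finite lists of conditions, and [r l] meets those listed in [l]; a given
    condition therefore holds from the index that lists it onwards. *)
Lemma approx_retraction_exists (J : Type) (A B Z : J -> lmodType R)
    (f : forall j, {linear A j -> B j}) (q : forall j, {linear B j -> Z j}) :
    (forall j, injective (f j)) -> (forall j, exact_at (f j) (q j)) ->
    (forall j, fp_lifting (q j)) ->
  exists (L : Type) (F : set_system L) (r : L -> forall j, B j -> A j),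
    ProperFilter F /\ approx_retraction f F r.
Proof.
move=> f_inj ex lift; pose L := forall j, seq {classic retraction_condition (A j) (B j)}.
pose F : set_system L :=
  [set P | exists l0 : L, forall l : L, (forall j, {subset l0 j <= l j}) -> P l]%classic.
have [r rP] : exists r : L -> forall j, B j -> A j,
    forall (l : L) j k, k \in l j -> satisfies (f j) (r l j) k.
  have ex_r (l : L) : exists r : forall j, B j -> A j,
      forall j k, k \in l j -> satisfies (f j) (r j) k.
    apply: (dep_choice (P := fun j r => forall k, k \in l j -> satisfies (f j) r k)) => j.
    exact: finite_retraction (f_inj j) (ex j) (lift j) (l j).
  by have [r rP] := choice ex_r; exists r.
have near_sat j (k : retraction_condition (A j) (B j)) :
    F [set l | satisfies (f j) (r l j) k]%classic.
  have [l0 l0P] : exists l0 : L, (k : {classic retraction_condition (A j) (B j)}) \in l0 j.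
    have [l0 l0P] : exists l0 : L, forall j' (E : j = j'),
        (ecast j' {classic retraction_condition (A j') (B j')} E k) \in l0 j'.
      apply: (@dep_choice _ (fun j' => seq {classic retraction_condition (A j') (B j')})
        (fun j' s => forall E : j = j',
           (ecast j' {classic retraction_condition (A j') (B j')} E k) \in s)) => j'.
      have [E|nE] := pselect (j = j'); last by exists [::] => E.
      subst j'; exists [:: (k : {classic _})] => E.
      by rewrite (Prop_irrelevance E erefl) inE.
    by exists l0; apply: (l0P j erefl).
  by exists l0 => l sub; apply: rP; apply: sub.
exists L, F, r; split.
  split.
    by case=> l0 l0P; apply: (l0P l0) => j k.
  split.
  - by exists (fun _ => [::]).
  - move=> P P' [l0 l0P] [l1 l1P]; exists (fun j => l0 j ++ l1 j) => l sub; split.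
      by apply: l0P => j k kl; apply: sub; rewrite mem_cat kl.
    by apply: l1P => j k kl; apply: sub; rewrite mem_cat kl orbT.
  - by move=> P P' sub [l0 l0P]; exists l0 => l /l0P/sub.
split=> [j a|j c b b']; first exact: near_sat (inl a).
exact: near_sat (inr (c, b, b')).
Qed.

End ApproximateRetraction.

(** * Tensor products and purity *)

Section TensorMaps.
Variables (R : pzRingType) (Q : quiver) (S : rep R^c (op_quiver Q)).
Implicit Types X Y Z : rep R Q.

Lemma tensor_ind X (P : tensor S X -> Prop) :
  P 0 -> (forall i (s : S i) (x : X i) t, P t -> P (pure_tensor s x + t)) ->
  forall t, P t.
Proof.
move=> P0 PD t; rewrite -[t]tensor_class_repr.
elim: (repr t) => [|[i [s x]] w IH]; first exact: P0.
pose k : tensor_gen S X := Tagged (fun i : Q => (S i * X i)%type) (s, x).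
have -> : tensor_class (k :: w : formal_sum S X) = pure_tensor s x + tensor_class w.
  apply: tensor_separated => H psi.
  rewrite (raddfD (tensor_lift psi)) /= !tensor_lift_class.
  by rewrite /sum_value big_cons big_seq1.
exact: PD.
Qed.

Lemma tensor_ext X (G : zmodType) (h h' : {additive tensor S X -> G}) :
  (forall i (s : S i) (x : X i), h (pure_tensor s x) = h' (pure_tensor s x)) ->
  forall t, h t = h' t.
Proof.
move=> hh' t; elim/tensor_ind: t => [|i s x t IH]; first by rewrite !raddf0.
by rewrite !raddfD hh' IH.
Qed.

(** The hypotheses say that [b] is biadditive and balanced, both over [R] and along the arrows. *)
Lemma hom_rep_exists X (G : zmodType) (b : forall i, S i -> X i -> G) :
    (forall i (s : S i), zmod_morphism (b i s)) ->
    (forall i (a : R^c) (s s' : S i) x, b i (a *: s + s') x = b i s ((a : R) *: x) + b i s' x) ->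
    (forall i j (a : arr (q := Q) i j) (s : S j) x,
      b i (rep_map S (a : arr (q := op_quiver Q) j i) s) x = b j s (rep_map X a x)) ->
  exists phi : rep_hom S (hom_rep X G),
    forall i (s : S i) x, (phi i s : {additive _ -> _}) x = b i s x.
Proof.
move=> b_add b_lin b_nat.
pose phi_at i (s : S i) : homZ (X i) G :=
  HB.pack (b i s) (GRing.isZmodMorphism.Build _ _ (b i s) (b_add i s)).
have phi_lin i : linear (@phi_at i : S i -> hom_rep X G i).
  by move=> a s s'; apply: homZ_ext => x; apply: b_lin.
have phi_nat (i j : op_quiver Q) (a : arr i j) (s : S i) :
    linear_of (phi_lin j) (rep_map S a s) = rep_map (hom_rep X G) a (linear_of (phi_lin i) s).
  by apply: homZ_ext => x; apply: b_nat.
by exists (RepHom (X := S) (Y := hom_rep X G) (rep_hom_at := fun i => linear_of (phi_lin i))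
  phi_nat).
Qed.

Lemma tensor_map_surj X Y (g : rep_hom X Y) : rep_epi g -> surj (tensor_map S g).
Proof.
move=> g_epi t; elim/tensor_ind: t => [|i s y t [t' <-]]; first by exists 0; rewrite raddf0.
have [x <-] := g_epi i y.
by exists (pure_tensor s x + t'); rewrite raddfD tensor_map_pure.
Qed.

(** Right exactness, by inverting the map from the cokernel of S ⊗ f to S ⊗ Z: s ⊗ z goes to the
    class of s ⊗ y for a preimage y of z. Two preimages differ by the image of [f], so the choice
    [lft] may be a mere function. *)
Lemma tensor_map_exact X Y Z (f : rep_hom X Y) (g : rep_hom Y Z) :
  rep_exact_at f g -> rep_epi g -> exact_at (tensor_map S f) (tensor_map S g).
Proof.
move=> fg_exact g_epi t; split=> [gt0|[t' <-]]; last first.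
  have gf0 : forall t', (tensor_map S g \o tensor_map S f) t' = (\0 : tensor S X -> tensor S Z) t'.
    apply: tensor_ext => i s x.
    by rewrite /= !tensor_map_pure (exact_comp0 (fg_exact i)) raddf0.
  exact: gf0.
pose im t := exists t', tensor_map S f t' = t.
have im0 : im 0 by exists 0; rewrite raddf0.
have imB x y : im x -> im y -> im (x - y).
  by move=> [x' <-] [y' <-]; exists (x' - y'); rewrite raddfB.
pose N := Subgroup im0 imB.
pose lft i := projT1 (choice (g_epi i)).
have lftE i z : g i (lft i z) = z by apply: projT2 (choice (g_epi i)) z.
have lft_eq i (s : S i) y :
    quot_proj N (pure_tensor s (lft i (g i y))) = quot_proj N (pure_tensor s y).
  apply/eqP; rewrite -subr_eq0 -raddfB; apply/eqP/quot_proj_eq0.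
  rewrite -raddfB; have /fg_exact[x <-] : g i (lft i (g i y) - y) = 0 by rewrite linearB lftE subrr.
  by exists (pure_tensor s x); rewrite tensor_map_pure.
have [|i a s s' z|i j a s z|phi phiE] :=
    @hom_rep_exists Z (quot N) (fun i s z => quot_proj N (pure_tensor s (lft i z))).
- move=> i s z z'; rewrite -{1}[z]lftE -{1}[z']lftE -linearB lft_eq.
  by rewrite -raddfB -raddfB.
- rewrite -{2}[z]lftE -linearZ lft_eq -raddfD; congr (quot_proj N _).
  have := congr1 (fun h : homZ _ _ => (h : {additive _ -> _}) (lft i z))
    (linearP (tensor_unit S Y i) a s s').
  by [].
- rewrite -{2}[z]lftE -rep_hom_natural lft_eq; congr (quot_proj N _).
  have := congr1 (fun h : homZ _ _ => (h : {additive _ -> _}) (lft i z))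
    (rep_hom_natural (tensor_unit S Y) (a : arr (q := op_quiver Q) j i) s).
  by [].
have key : forall t, (tensor_lift phi \o tensor_map S g) t = quot_proj N t.
  apply: tensor_ext => i s y.
  rewrite -[LHS]/(tensor_lift phi (tensor_map S g (pure_tensor s y))).
  by rewrite tensor_map_pure tensor_lift_pure phiE lft_eq.
by apply/(quot_proj_eq0 N); rewrite -key /= gt0 -[RHS](raddf0 (tensor_lift phi)).
Qed.

(* S ⊗ f is injective as S -> Hom(X, G) extends along f to S -> Hom(Y, G'),
   where G' is the reduced power of G modulo the filter. *)
Lemma tensor_map_inj X Y (f : rep_hom X Y) (L : Type) (F : set_system L)
    (r : L -> forall i, Y i -> X i) :
    ProperFilter F -> approx_retraction f F r ->
    (forall i j (a : arr i j) y,
      \forall l \near F, r l j (rep_map Y a y) = rep_map X a (r l i y)) ->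
  injective (tensor_map S f).
Proof.
move=> PF [r_id r_lin] r_nat.
have rD i y y' : \forall l \near F, r l i (y + y') = r l i y + r l i y'.
  by apply: filterS (r_lin i 1 y y') => l; rewrite !scale1r.
have r0 i : \forall l \near F, r l i 0 = 0.
  apply: filterS (rD i 0 0) => l; rewrite addr0 => /eqP.
  by rewrite addrC -subr_eq subrr eq_sym => /eqP.
have rZ i c y : \forall l \near F, r l i (c *: y) = c *: r l i y.
  apply: filterS2 (r_lin i c y 0) (r0 i) => l.
  by rewrite addr0 => -> ->; rewrite addr0.
have rB i y y' : \forall l \near F, r l i (y - y') = r l i y - r l i y'.
  by apply: filterS (r_lin i (-1) y' y) => l; rewrite !scaleN1r ![- _ + _]addrC.
suff ker t : tensor_map S f t = 0 -> t = 0.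
  move=> t t' E; apply/eqP; rewrite -subr_eq0; apply/eqP/ker.
  by rewrite raddfB E subrr.
move=> ft0; apply: tensor_separated => G phi; rewrite [RHS](raddf0 (tensor_lift phi)).
pose null (g : L -> G) := \forall l \near F, g l = 0.
have null0 : null 0 by apply: filterE.
have nullB g h : null g -> null h -> null (g - h).
  move=> g0 h0; apply: filterS2 g0 h0 => l gl hl.
  by rewrite /= [(g - h) l](_ : _ = g l - h l) // gl hl subrr.
pose N := Subgroup null0 nullB.
have quot_eq (g h : L -> G) : (\forall l \near F, g l = h l) -> quot_proj N g = quot_proj N h.
  move=> gh; apply/eqP; rewrite -subr_eq0 -raddfB; apply/eqP/quot_proj_eq0.
  by apply: filterS gh => l E; rewrite [(g - h) l](_ : _ = g l - h l) // E subrr.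
have [|i a s s' y|i j a s y|phi' phi'E] :=
    @hom_rep_exists Y (quot N)
      (fun i s y => quot_proj N (fun l => (phi i s : {additive _ -> _}) (r l i y))).
- move=> i s y y'; rewrite -raddfB; apply: quot_eq; apply: filterS (rB i y y') => l ->.
  by rewrite raddfB.
- rewrite -raddfD; apply: quot_eq; apply: filterS (rZ i a y) => l E.
  rewrite linearP -[RHS]/((phi i s : {additive _ -> _}) (r l i (_ *: y)) +
    (phi i s' : {additive _ -> _}) (r l i y)).
  by rewrite E.
- by apply: quot_eq; apply: filterS (r_nat _ _ a y) => l ->; rewrite rep_hom_natural.
(* The diagonal of G into its reduced power; it is injective because [F] is proper. *)
have diag_add : zmod_morphism (fun g : G => quot_proj N (fun=> g)).
  by move=> g h; rewrite -raddfB.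
pose diag : {additive G -> quot N} := HB.pack (fun g : G => quot_proj N (fun=> g))
  (GRing.isZmodMorphism.Build _ _ _ diag_add).
have key : forall t, (tensor_lift phi' \o tensor_map S f) t = (diag \o tensor_lift phi) t.
  apply: tensor_ext => i s x.
  rewrite -[LHS]/(tensor_lift phi' (tensor_map S f (pure_tensor s x))).
  rewrite -[RHS]/(diag (tensor_lift phi (pure_tensor s x))).
  rewrite tensor_map_pure !tensor_lift_pure phi'E.
  by apply: quot_eq; apply: filterS (r_id i x) => l ->.
have /quot_proj_eq0 : diag (tensor_lift phi t) = 0.
  by rewrite -[LHS]key /= ft0 [LHS](raddf0 (tensor_lift phi')).
by move=> /filter_ex[].
Qed.

End TensorMaps.

(** * Cofree and injective representations *)

Section Paths.
Variable Q : quiver.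

Inductive qpath : Q -> Q -> Type :=
| path_nil i : qpath i i
| path_cons i j k (a : arr i j) (p : qpath j k) : qpath i k.

Definition out_path (i : Q) := {j : Q & qpath i j}.
Definition out_nil (i : Q) : out_path i := Tagged (qpath i) (path_nil i).
Definition out_cons (i : Q) (a : out_arrow i) (p : out_path (tag a)) : out_path i :=
  Tagged (qpath i) (path_cons (tagged a) (tagged p)).

(** Targets precede sources: induction at i may use the claim at t(a) for every arrow a leaving
    i. *)
Definition arrow_rel (j i : Q) : Prop := inhabited (arr i j).

(** From an inaccessible vertex some arrow leads to another inaccessible one, and iterating this
    choice gives an infinite path. *)
Lemma right_rooted_wf : right_rooted Q -> well_founded arrow_rel.
Proof.
move=> rooted i; apply: contrapT => not_acc; apply: rooted.
have step (x : {i | ~ Acc arrow_rel i}) : exists y : {i | ~ Acc arrow_rel i},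
    inhabited (arr (sval x) (sval y)).
  case: x => x xP; apply: contrapT => none; apply: (xP); split=> y a.
  by apply: contrapT => yP; apply: none; exists (exist _ y yP).
have [next nextP] := choice step.
pose v n := sval (iter n next (exist _ i not_acc)).
exists v; split=> n; exact: inhabited_witness (nextP _).
Qed.

End Paths.

Arguments out_nil {Q} i.
Arguments out_cons {Q i} a p.

Lemma out_pathP (Q : quiver) (i : Q) (p : out_path i) :
  p = out_nil i \/ exists a q, p = out_cons a q.
Proof.
case: p => k p; case: p => [j|j l m a q]; [by left | right].
by exists (Tagged _ a), (Tagged _ q).
Qed.

Section Representations.
Variables (R : pzRingType) (Q : quiver).
Implicit Types (X Y Z : rep R Q) (E : Q -> lmodType R).

Definition psi_map X Y (f : rep_hom X Y) (i : Q)
    (z : prodmod (fun a : out_arrow i => X (tag a))) :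
    prodmod (fun a : out_arrow i => Y (tag a)) :=
  fun a => f (tag a) (z a).

Lemma psi_natural X Y (f : rep_hom X Y) i x : psi Y i (f i x) = psi_map f (psi X i x).
Proof. by apply: functional_extensionality_dep => a; rewrite /= /psi_fun -rep_hom_natural. Qed.

Fixpoint rep_path X (i j : Q) (p : qpath i j) : {linear X i -> X j} :=
  match p in qpath i j return {linear X i -> X j} with
  | path_nil i => idfun
  | path_cons _ _ _ a q => rep_path X q \o rep_map X a
  end.

Section Cofree.
Variable E : Q -> lmodType R.

Definition cofree_obj (i : Q) := prodmod (fun p : out_path i => E (tag p)).

Fact cofree_map_linear i j (a : arr i j) :
  linear (fun (x : cofree_obj i) => (fun p => x (out_cons (Tagged _ a) p)) : cofree_obj j).
Proof. by []. Qed.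

Definition cofree : rep R Q :=
  Rep (rep_obj := cofree_obj) (fun i j a => linear_of (@cofree_map_linear i j a)).

Definition cofree_eval (i : Q) : {linear cofree i -> E i} := prod_proj _ (out_nil i).

Definition cofree_nil_fun (i : Q) (e : E i) : cofree i := fun p =>
  match tagged p in qpath i j return E i -> E j with
  | path_nil i => id
  | path_cons _ _ _ _ _ => fun=> 0
  end e.

Fact cofree_nil_linear i : linear (@cofree_nil_fun i).
Proof.
move=> c e e'; apply: functional_extensionality_dep => -[j p].
rewrite -[RHS]/(c *: cofree_nil_fun e _ + cofree_nil_fun e' _) /cofree_nil_fun /=.
by case: p e e' => //= *; rewrite addr0 scaler0.
Qed.

Definition cofree_nil i : {linear E i -> cofree i} := linear_of (@cofree_nil_linear i).

Definition cofree_cons_fun (i : Q) (z : prodmod (fun a : out_arrow i => cofree (tag a))) :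
    cofree i := fun p =>
  match tagged p in qpath i j
    return prodmod (fun a : out_arrow i => cofree (tag a)) -> E j with
  | path_nil i => fun=> 0
  | path_cons _ _ _ a q => fun z => z (Tagged _ a) (Tagged _ q)
  end z.

Fact cofree_cons_linear i : linear (@cofree_cons_fun i).
Proof.
move=> c e e'; apply: functional_extensionality_dep => -[j p].
rewrite -[RHS]/(c *: cofree_cons_fun e _ + cofree_cons_fun e' _) /cofree_cons_fun /=.
by case: p e e' => //= *; rewrite addr0 scaler0.
Qed.

Definition cofree_cons i : {linear prodmod (fun a : out_arrow i => cofree (tag a)) -> cofree i} :=
  linear_of (@cofree_cons_linear i).

Lemma cofree_evalK i e : cofree_eval i (cofree_nil i e) = e.
Proof. by []. Qed.

Lemma cofree_psiK i z : psi cofree i (cofree_cons i z) = z.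
Proof.
apply: functional_extensionality_dep => -[j a].
by apply: functional_extensionality_dep => -[k p].
Qed.

Lemma psi_cofree_nil i e : psi cofree i (cofree_nil i e) = 0.
Proof.
apply: functional_extensionality_dep => -[j a].
by apply: functional_extensionality_dep => -[k p].
Qed.

Lemma cofree_decomp i x :
  x = cofree_nil i (cofree_eval i x) + cofree_cons i (psi cofree i x).
Proof.
apply: functional_extensionality_dep => -[j p].
rewrite -[RHS]/(cofree_nil_fun (cofree_eval i x) _ + cofree_cons_fun (psi cofree i x) _).
rewrite /cofree_nil_fun /cofree_cons_fun /=.
by case: p x => [k|k l m a p] x; rewrite /= ?addr0 ?add0r.
Qed.

Lemma cofree_ker_psi i x : psi cofree i x = 0 -> x = cofree_nil i (cofree_eval i x).
Proof. by move=> x0; rewrite {1}[x]cofree_decomp x0 linear0 addr0. Qed.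

Lemma cofree_eq0 i x : psi cofree i x = 0 -> cofree_eval i x = 0 -> x = 0.
Proof. by move=> /cofree_ker_psi -> ; rewrite cofree_evalK => ->; rewrite linear0. Qed.

Section Adjunction.
Variables (Y : rep R Q) (g : forall j, {linear Y j -> E j}).

Definition cofree_adj_at i : {linear Y i -> cofree i} :=
  prod_pair (fun p : out_path i => g (tag p) \o rep_path Y (tagged p)).

Fact cofree_adj_natural i j (a : arr i j) y :
  cofree_adj_at j (rep_map Y a y) = rep_map cofree a (cofree_adj_at i y).
Proof. by []. Qed.

Definition cofree_adj : rep_hom Y cofree := RepHom cofree_adj_natural.

Lemma cofree_eval_adj i y : cofree_eval i (cofree_adj i y) = g i y.
Proof. by []. Qed.

End Adjunction.

(** By naturality the coordinate at a path is the coordinate at the empty path of its end vertex. *)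
Lemma cofree_hom_ext Y (h h' : rep_hom Y cofree) :
  (forall i y, cofree_eval i (h i y) = cofree_eval i (h' i y)) ->
  forall i y, h i y = h' i y.
Proof.
move=> hh' i y; apply: functional_extensionality_dep => -[j p].
elim: p y => [k|k l m a p IH] y; first exact: hh'.
have natE (f : rep_hom Y cofree) :
    f k y (Tagged (qpath k) (path_cons a p)) = f l (rep_map Y a y) (Tagged (qpath l) p).
  by rewrite rep_hom_natural.
by rewrite !natE.
Qed.

Lemma cofree_injective : (forall j, injective_module (E j)) -> injective_rep cofree.
Proof.
move=> E_inj X Y f g f_mono.
have [h hE] := dep_choice (fun j => E_inj j _ _ (f j) (cofree_eval j \o g j) (f_mono j)).
exists (cofree_adj h); apply: (@cofree_hom_ext X (rep_comp (cofree_adj h) f) g) => i x.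
exact: hE.
Qed.

End Cofree.

Definition cofree_functor_at (E E' : Q -> lmodType R) (f : forall j, {linear E j -> E' j}) i :
    {linear cofree E i -> cofree E' i} :=
  prod_pair (fun p : out_path i => f (tag p) \o prod_proj _ p).

Definition cofree_functor (E E' : Q -> lmodType R) (f : forall j, {linear E j -> E' j}) :
    rep_hom (cofree E) (cofree E') :=
  RepHom (X := cofree E) (Y := cofree E') (rep_hom_at := cofree_functor_at f)
    (fun _ _ _ _ => erefl).

Lemma cofree_functor_mono E E' (f : forall j, {linear E j -> E' j}) :
  (forall j, injective (f j)) -> rep_mono (cofree_functor f).
Proof.
move=> f_inj i x y xy; apply: functional_extensionality_dep => p.
exact: f_inj (congr1 (fun z => z p) xy).
Qed.

Lemma cofree_functor_epi E E' (f : forall j, {linear E j -> E' j}) :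
  (forall j, surj (f j)) -> rep_epi (cofree_functor f).
Proof.
move=> f_surj i y; have [x xE] := dep_choice (fun p : out_path i => f_surj (tag p) (y p)).
by exists x; apply: functional_extensionality_dep => p; apply: xE.
Qed.

Lemma cofree_functor_exact E E' E'' (f : forall j, {linear E j -> E' j})
    (g : forall j, {linear E' j -> E'' j}) :
  (forall j, exact_at (f j) (g j)) -> rep_exact_at (cofree_functor f) (cofree_functor g).
Proof.
move=> ex i y; split=> [gy|[x <-]].
  have lift_y (p : out_path i) : exists x, f (tag p) x = y p.
    by apply/ex; apply: (congr1 (fun z => z p) gy).
  have [x xE] := dep_choice lift_y.
  by exists x; apply: functional_extensionality_dep => p; apply: xE.
by apply: functional_extensionality_dep => p; apply/ex; exists (x p).
Qed.

Section InjectiveRep.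
Variable I : rep R Q.
Hypothesis I_inj : injective_rep I.

Lemma injective_rep_retract : exists E : Q -> lmodType R, (forall j, injective_module (E j)) /\
  exists (s : rep_hom I (cofree E)) (r : rep_hom (cofree E) I), forall i x, r i (s i x) = x.
Proof.
have hull j : exists E : lmodType R,
    injective_module E /\ exists e : {linear I j -> E}, injective e.
  by have [E E_inj e] := enough_injective_modules (I j); exists E.
have [E EP] := choice hull; exists E; split=> [j|]; first by case: (EP j).
have [e e_inj] := dep_choice (fun j => (EP j).2).
have s_mono : rep_mono (cofree_adj e).
  move=> i x y xy; apply: (e_inj i).
  exact: (congr1 (cofree_eval E i) xy).
have id_natural i j (a : arr i j) (x : I i) :
  (idfun : {linear I j -> I j}) (rep_map I a x) =
    rep_map I a ((idfun : {linear I i -> I i}) x) by [].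
have [r rE] := I_inj (RepHom id_natural) s_mono.
by exists (cofree_adj e), r.
Qed.

Lemma injective_rep_at i : injective_module (I i).
Proof.
have [E [E_inj [s [r rs]]]] := injective_rep_retract.
have CE_inj : injective_module (cofree E i) by apply: prod_injective_module.
move=> U V f g f_inj; have [h hE] := CE_inj _ _ f (s i \o g) f_inj.
by exists (r i \o h) => x; rewrite /= hE /= rs.
Qed.

(** On a cofree representation [cofree_cons] is a section; a retract inherits it by naturality of
    [psi]. *)
Lemma injective_rep_psi_section i :
  exists t : {linear prodmod (fun a : out_arrow i => I (tag a)) -> I i},
    forall z, psi I i (t z) = z.
Proof.
have [E [E_inj [s [r rs]]]] := injective_rep_retract.
exists (r i \o cofree_cons E i \o
  prod_pair (fun a : out_arrow i => s (tag a) \o prod_proj _ a)) => z.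
rewrite /comp psi_natural cofree_psiK.
by apply: functional_extensionality_dep => a; apply: rs.
Qed.

(** The section t of [psi] makes the kernel a direct summand of I(i), with projection 1 - t psi. *)
Lemma injective_rep_ker_psi i : injective_module (kernel (psi I i)).
Proof.
have [t tE] := injective_rep_psi_section i.
move=> U V f g f_inj.
have [h hE] := @injective_rep_at i _ _ f (kernel_incl _ \o g) f_inj.
have [|h' h'E] := @lift_inj _ _ _ _ (kernel_incl (psi I i)) (h \- (t \o psi I i \o h))
    (@kernel_incl_inj _ _ _ _).
  by move=> x; apply/kernel_incl_exact; rewrite linearB /comp tE subrr.
exists h' => x; apply: (@kernel_incl_inj _ _ _ (psi I i)).
have psi0 : psi I i (kernel_incl _ (g x)) = 0 by apply: exact_comp0 (g x); apply: kernel_incl_exact.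
by rewrite h'E -[LHS]/(h (f x) - t (psi I i (h (f x)))) hE psi0 linear0 subr0.
Qed.

End InjectiveRep.

Section WellFounded.
Hypothesis Q_wf : well_founded (@arrow_rel Q).

(** Naturality for the arrows leaving i involves only the components at i and at their targets, so a
    morphism can be built by recursion from targets to sources; [P] is the property that the
    recursion maintains. *)
Lemma rep_hom_rec Y Z (P : forall i, {linear Y i -> Z i} -> Prop) :
    (forall i (v : forall a : out_arrow i, {linear Y (tag a) -> Z (tag a)}),
       (forall a, P (tag a) (v a)) ->
     exists2 w : {linear Y i -> Z i}, P i w &
       forall a y, v a (psi Y i y a) = psi Z i (w y) a) ->
  exists h : rep_hom Y Z, forall i, P i (h i).
Proof.
move=> step.
pose good i (v : forall j, arrow_rel j i -> {linear Y j -> Z j}) (w : {linear Y i -> Z i}) :=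
  P i w /\ forall a y, v (tag a) (inhabits (tagged a)) (psi Y i y a) = psi Z i (w y) a.
(* The default 0 is never reached: [h_good] shows by induction that a good component exists. *)
pose next i v : {linear Y i -> Z i} :=
  if pselect (exists w, good i v w) is left ex then projT1 (cid ex) else \0.
pose h := Fix Q_wf _ next.
have hE i : h i = next i (fun j _ => h j).
  apply: Fix_eq => {}i v v' vv'; congr (next i _).
  apply: functional_extensionality_dep => j.
  by apply: functional_extensionality_dep => a; apply: vv'.
have h_good i : good i (fun j _ => h j) (h i).
  elim/(well_founded_ind Q_wf): i => i IH.
  have ex : exists w, good i (fun j _ => h j) w.
    have [a|w Pw wE] := step i (fun a => h (tag a)); last by exists w.
    by case: (IH _ (inhabits (tagged a))).
  rewrite hE /next; case: pselect => // {}ex.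
  by case: (cid ex).
have h_nat i j (a : arr i j) y : h j (rep_map Y a y) = rep_map Z a (h i y).
  by have [_ /(_ (Tagged _ a) y)] := h_good i.
by exists (RepHom h_nat) => i; case: (h_good i).
Qed.

(** The adjunction describes maps into a cofree representation only. A map out of it can still be
    prescribed on the summands E(j), provided that [psi X] allows the rest to be lifted. *)
Lemma cofree_out (E : Q -> lmodType R) X (g : forall j, {linear E j -> X j}) :
    (forall j e, psi X j (g j e) = 0) ->
    (forall j (u : {linear cofree E j -> prodmod (fun a : out_arrow j => X (tag a))}),
       exists v : {linear cofree E j -> X j}, forall x, psi X j (v x) = u x) ->
  exists h : rep_hom (cofree E) X, forall j e, h j (cofree_nil E j e) = g j e.
Proof.
move=> psi_g lift.
apply: (rep_hom_rec (P := fun j (h : {linear cofree E j -> X j}) =>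
  forall e, h (cofree_nil E j e) = g j e)) => i v vE.
pose vv := prod_pair (fun a : out_arrow i => v a \o prod_proj (fun a => cofree E (tag a)) a).
have [w wE] := lift i (vv \o psi (cofree E) i).
have w_nil e : psi X i (w (cofree_nil E i e)) = 0.
  by rewrite wE -[LHS]/(vv (psi (cofree E) i (cofree_nil E i e))) psi_cofree_nil linear0.
(* The lift is corrected on the summand E(i) alone; the correction has values in Ker psi and so
   leaves naturality intact. *)
exists (w \+ ((g i \- (w \o cofree_nil E i)) \o cofree_eval E i)) => [e|a y].
  by rewrite /= addrC subrK.
pose e := cofree_eval E i y.
rewrite -[RHS]/(psi X i (w y + (g i e - w (cofree_nil E i e))) a).
by rewrite linearD linearB psi_g w_nil subr0 addr0 wE.
Qed.

(** Lifting the components of psi(z) at the targets, and then their family along [psi Y], leaves an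
    error in Ker psi. *)
Lemma rep_epi_by_ker Y Z (g : rep_hom Y Z) :
    (forall i, surj (psi Y i)) ->
    (forall i z, psi Z i z = 0 -> exists y, g i y = z) ->
  rep_epi g.
Proof.
move=> psi_surj ker i; elim/(well_founded_ind Q_wf): i => i IH z.
have [y' y'E] := dep_choice (fun a : out_arrow i => IH _ (inhabits (tagged a)) (psi Z i z a)).
have [y yE] := psi_surj i y'.
have [|y0 y0E] := ker i (z - g i y).
  rewrite linearB psi_natural yE; apply/eqP; rewrite subr_eq0; apply/eqP.
  by apply: functional_extensionality_dep => a; rewrite /psi_map y'E.
by exists (y + y0); rewrite linearD y0E addrC subrK.
Qed.

End WellFounded.

End Representations.

(** * Kernels and cokernels of representations; purity seen at the vertices *)

Section RepMaps.
Variables (R : pzRingType) (Q : quiver).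
Implicit Types U V W X Y Z : rep R Q.

Lemma rep_lift_mono U V W (e : rep_hom V W) (u : rep_hom U W) :
  rep_mono e -> (forall i x, exists y, e i y = u i x) ->
  exists v : rep_hom U V, forall i x, e i (v i x) = u i x.
Proof.
move=> e_mono im; have [v vE] := dep_choice (fun i => lift_inj (e_mono i) (im i)).
have v_nat i j (a : arr i j) x : v j (rep_map U a x) = rep_map V a (v i x).
  by apply: (e_mono j); rewrite vE !rep_hom_natural vE.
by exists (RepHom v_nat).
Qed.

Lemma rep_factor_epi U V W (q : rep_hom U V) (u : rep_hom U W) :
  rep_epi q -> (forall i x, q i x = 0 -> u i x = 0) ->
  exists v : rep_hom V W, forall i x, v i (q i x) = u i x.
Proof.
move=> q_epi ker; have [v vE] := dep_choice (fun i => factor_surj (q_epi i) (ker i)).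
have v_nat i j (a : arr i j) x : v j (rep_map V a x) = rep_map W a (v i x).
  by have [y <-] := q_epi i x; rewrite -rep_hom_natural !vE rep_hom_natural.
by exists (RepHom v_nat).
Qed.

Lemma kernel_rep_exists X Y (f : rep_hom X Y) :
  exists (K : rep R Q) (k : rep_hom K X), rep_mono k /\ rep_exact_at k f.
Proof.
have ex (t : {i : Q & {j : Q & arr i j}}) :
    exists v : {linear kernel (f (tag t)) -> kernel (f (tag (tagged t)))},
      forall x, kernel_incl _ (v x) = rep_map X (tagged (tagged t)) (kernel_incl _ x).
  apply: (lift_inj (u := rep_map X (tagged (tagged t)) \o kernel_incl _)).
    exact: kernel_incl_inj.
  move=> x; apply/kernel_incl_exact; rewrite /comp rep_hom_natural.
  by rewrite (exact_comp0 (@kernel_incl_exact _ _ _ _)) linear0.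
have [v vE] := dep_choice ex.
pose K : rep R Q := @Rep R Q (fun i => kernel (f i)) (fun i j a => v (Tagged _ (Tagged _ a))).
have k_nat i j (a : arr i j) (x : K i) :
    kernel_incl (f j) (rep_map K a x) = rep_map X a (kernel_incl (f i) x).
  by rewrite (vE (Tagged _ (Tagged _ a))).
exists K, (RepHom (X := K) k_nat); split=> i; first exact: kernel_incl_inj.
exact: kernel_incl_exact.
Qed.

Lemma cokernel_rep_exists X Y (f : rep_hom X Y) :
  exists (C : rep R Q) (q : rep_hom Y C), rep_epi q /\ rep_exact_at f q.
Proof.
have ex i : exists C : lmodType R, exists q : {linear Y i -> C}, exact_at (f i) q /\ surj q.
  exact: cokernel_exists.
pose C i := projT1 (cid (ex i)).
have exq i : exists q : {linear Y i -> C i}, exact_at (f i) q /\ surj q.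
  exact: projT2 (cid (ex i)).
have [q qP] := dep_choice exq.
have exm (t : {i : Q & {j : Q & arr i j}}) :
    exists v : {linear C (tag t) -> C (tag (tagged t))},
      forall x, v (q _ x) = q _ (rep_map Y (tagged (tagged t)) x).
  apply: (factor_surj (u := q _ \o rep_map Y (tagged (tagged t)))); first by case: (qP (tag t)).
  move=> x; case: (qP (tag t)) => ext _ /ext[y <-].
  rewrite -[LHS]/(q _ (rep_map Y (tagged (tagged t)) (f _ y))) -rep_hom_natural.
  by case: (qP (tag (tagged t))) => ext' _; rewrite (exact_comp0 ext').
have [v vE] := dep_choice exm.
pose CC : rep R Q := @Rep R Q C (fun i j a => v (Tagged _ (Tagged _ a))).
have q_nat i j (a : arr i j) (x : Y i) :
    q j (rep_map Y a x) = rep_map CC a (q i x).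
  by rewrite -(vE (Tagged _ (Tagged _ a))).
exists CC, (RepHom (Y := CC) q_nat).
by split=> i; case: (qP i).
Qed.

(* Testing on S = Hom(X, G) with G = X(i)^m / M X(i)^n: the solution in Y kills the
   tensor which, under S ⊗ X -> G, becomes the class of the right-hand side. *)
Lemma pure_system_solvable X Y (u : rep_hom X Y) :
    (forall S : rep R^c (op_quiver Q), injective (tensor_map S u)) ->
  forall (i : Q) m n (M : 'M[R]_(m, n)) (a : 'I_m -> X i) (y : 'I_n -> Y i),
    (forall l, u i (a l) = \sum_k M l k *: y k) ->
  exists x : 'I_n -> X i, forall l, a l = \sum_k M l k *: x k.
Proof.
move=> u_pure i m n M a y yE.
pose V := prodmod (fun _ : 'I_m => X i).
pose im (v : V) := exists x : 'I_n -> X i, forall l, v l = \sum_k M l k *: x k.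
have im0 : im 0.
  by exists (fun _ => 0) => l; rewrite big1 // => k _; rewrite scaler0.
have imB v w : im v -> im w -> im (v - w).
  move=> [x xE] [x' x'E]; exists (fun k => x k - x' k) => l.
  rewrite -[LHS]/(v l - w l) xE x'E -sumrB.
  by apply: eq_bigr => k _; rewrite scalerBr.
pose N := Subgroup im0 imB.
pose at_ l (b : X i) : V := fun l' => if l' == l then b else 0.
have atB l : zmod_morphism (fun b => quot_proj N (at_ l b)).
  move=> b c; rewrite -raddfB; congr (quot_proj N _).
  apply: functional_extensionality_dep => l'.
  by rewrite -[RHS]/(at_ l b l' - at_ l c l') /at_; case: eqP; rewrite ?subr0.
pose S := hom_rep X (quot N).
pose s l : S i := (HB.pack (fun b => quot_proj N (at_ l b))
  (GRing.isZmodMorphism.Build _ _ _ (atB l)) : {additive X i -> quot N}).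
have sum_at (I : finType) (F : I -> V) l : (\sum_k F k) l = \sum_k F k l.
  by elim/big_rec2: _ => // k v w _ <-.
have sum_hom (I : finType) (F : I -> homZ (X i) (quot N)) b :
    ((\sum_k F k : homZ _ _) : {additive _ -> _}) b = \sum_k (F k : {additive _ -> _}) b.
  by elim/big_rec2: _ => // k v w _ <-.
(* Applied to b, the sum is the class of M times the vector with sole entry b in place k, hence
   zero. *)
have relation k : \sum_l (M l k : R^c) *: s l = 0.
  apply: homZ_ext => b; rewrite sum_hom -[RHS]/(0 : quot N).
  rewrite (eq_bigr (fun l => quot_proj N (at_ l (M l k *: b)))) // -raddf_sum.
  apply/quot_proj_eq0; exists (fun k' => if k' == k then b else 0) => l.
  rewrite sum_at (bigD1 l) //= /at_ eqxx big1 ?addr0 => [|l' /negbTE]; last by rewrite eq_sym => ->.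
  by rewrite (bigD1 k) //= eqxx big1 ?addr0 // => k' /negbTE ->; rewrite scaler0.
have pureE (Z : rep R Q) (t : S i) (z : Z i) :
  pure_tensor t z = (tensor_unit S Z i t : {additive _ -> _}) z by [].
(* In S ⊗ Y the equations move M across the tensor sign: [t] goes to the sum over k of (sum_l M_lk
   s_l) ⊗ y_k, which is zero by [relation]. *)
pose t := \sum_l pure_tensor (s l) (a l).
have t0 : t = 0.
  apply: (u_pure S); rewrite [RHS]raddf0 raddf_sum.
  have sumY (F : 'I_m -> homZ (Y i) (tensor S Y)) b :
    ((\sum_k F k : homZ _ _) : {additive _ -> _}) b = \sum_k (F k : {additive _ -> _}) b.
    by elim/big_rec2: _ => // k v w _ <-.
  transitivity (\sum_k pure_tensor (\sum_l (M l k : R^c) *: s l) (y k)); last first.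
    by apply: big1 => k _; rewrite relation pureE linear0.
  under eq_bigr => l _ do rewrite tensor_map_pure yE raddf_sum.
  rewrite exchange_big; apply: eq_bigr => k _ /=.
  rewrite pureE linear_sum sumY; apply: eq_bigr => l _.
  by rewrite linearZ.
have id_nat (j k : op_quiver Q) (b : arr j k) (h : S j) :
  (idfun : {linear S k -> hom_rep X (quot N) k}) (rep_map S b h) =
  rep_map (hom_rep X (quot N)) b ((idfun : {linear S j -> hom_rep X (quot N) j}) h) by [].
pose phi : rep_hom S (hom_rep X (quot N)) := RepHom id_nat.
suff /quot_proj_eq0[x xE] : quot_proj N (a : V) = 0 by exists x.
have <- : tensor_lift phi t = 0 by rewrite t0; apply: (raddf0 (tensor_lift phi)).
rewrite raddf_sum (eq_bigr (fun l => quot_proj N (at_ l (a l)))); last first.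
  by move=> l _; rewrite tensor_lift_pure.
rewrite -raddf_sum; congr (quot_proj N _); apply: functional_extensionality_dep => l.
rewrite sum_at (bigD1 l) //= /at_ eqxx big1 ?addr0 // => l' /negbTE.
by rewrite eq_sym => ->.
Qed.

(** Lift the generators of P to elements y_k of Y. The relations then hold up to elements a_l of X;
    purity solves the system with right-hand sides a_l by x_k in X, and the y_k - u(x_k) satisfy the
    relations exactly. *)
Lemma pure_fp_lifting X Y Z (u : rep_hom X Y) (p : rep_hom Y Z) :
  pure_short_exact u p -> forall i, fp_lifting (p i).
Proof.
move=> [[u_mono up_exact p_epi] pure] i P [m [n [f [g [fg_exact g_surj]]]]] w.
have [y yE] := choice (fun k : 'I_n => p_epi i (w (g (delta_mx 0 k)))).
have comb_lin (B : lmodType R) (b : 'I_n -> B) : linear (fun v : 'rV[R]_n => \sum_k v 0 k *: b k).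
  move=> c v v'; rewrite scaler_sumr -big_split /=; apply: eq_bigr => k _.
  by rewrite !mxE scalerDl scalerA.
pose comb (B : lmodType R) (b : 'I_n -> B) : {linear 'rV[R]_n -> B} := linear_of (comb_lin B b).
have comb_hom (B C : lmodType R) (h : {linear B -> C}) b v :
    h (comb B b v) = comb C (fun k => h (b k)) v.
  by rewrite linear_sum; apply: eq_bigr => k _; rewrite linearZ.
have comb_w v : comb _ (fun k => w (g (delta_mx 0 k))) v = w (g v).
  rewrite [v in RHS]row_sum_delta !linear_sum; apply: eq_bigr => k _.
  by rewrite !linearZ.
have pcomb v : p i (comb _ y v) = w (g v).
  by rewrite comb_hom -comb_w; apply: eq_bigr => k _; rewrite yE.
pose M : 'M[R]_(m, n) := \matrix_(l, k) f (delta_mx 0 l) 0 k.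
have a_ex l : exists a, u i a = comb _ y (f (delta_mx 0 l)).
  by apply/up_exact; rewrite pcomb (exact_comp0 fg_exact) linear0.
have [a aE] := choice a_ex.
have [|x xE] := @pure_system_solvable _ _ u (fun S => let: And3 h _ _ := pure S in h) i m n M a y.
  by move=> l; rewrite aE; apply: eq_bigr => k _; rewrite mxE.
have [|v vE] := @factor_surj _ _ _ _ g (comb _ (fun k => y k - u i (x k))) g_surj.
  move=> z /fg_exact[b <-]; rewrite [b]row_sum_delta !linear_sum big1 // => l _.
  rewrite !linearZ_LR (_ : comb _ _ _ = 0) ?scaler0 //.
  transitivity (comb _ y (f (delta_mx 0 l)) - u i (comb _ x (f (delta_mx 0 l)))).
    rewrite comb_hom -[LHS]/(\sum_k _) -sumrB.
    by apply: eq_bigr => k _; rewrite scalerBr.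
  rewrite -aE -linearB (_ : a l - _ = 0) ?linear0 //.
  apply/eqP; rewrite subr_eq0 xE; apply/eqP.
  by apply: eq_bigr => k _; rewrite mxE.
exists v => z; have [b <-] := g_surj z.
rewrite vE comb_hom -comb_w; apply: eq_bigr => k _.
by rewrite linearB yE (exact_comp0 (up_exact i)) subr0.
Qed.

Lemma sfp_rep_at X : strongly_fp_injective_rep X -> forall i, strongly_fp_injective_module (X i).
Proof.
move=> [E [e [d [E_inj [e_mono e_exact d_exact pure]]]]] i.
apply: (@sfp_of_coresolution R (fun n => E n i) (fun n => d n i) (X i) (e i)) => //.
- by move=> n; apply: injective_rep_at.
- by move=> n; apply: d_exact.
move=> P P_fp n u u0.
(* [d n] is factored through the kernel of [d n.+1], which is its image, so that the purity clause
   applies. *)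
have [A [k [k_mono k_exact]]] := kernel_rep_exists (d n).
have [B [m [m_mono m_exact]]] := kernel_rep_exists (d n.+1).
have [|p pE] := @rep_lift_mono _ _ _ m (d n) m_mono.
  by move=> j x; apply/m_exact/d_exact; exists x.
have p_epi : rep_epi p.
  move=> j b; have /d_exact[x xE] : d n.+1 j (m j b) = 0 by apply/m_exact; exists b.
  by exists x; apply: (m_mono j); rewrite pE.
have kp_exact : rep_exact_at k p.
  move=> j x; apply: iff_trans (k_exact j x); rewrite -pE.
  exact: iff_sym (injective_eq0 (m_mono j) _).
have {}pure := pure n A B k p m (And3 k_mono kp_exact p_epi) m_mono pE.
have [|u' u'E] := @lift_inj _ _ _ _ (m i) u (m_mono i).
  by move=> x; apply/m_exact/u0.
have [v vE] := pure_fp_lifting pure P_fp u'.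
by exists v => x; rewrite -pE vE u'E.
Qed.

End RepMaps.

(** * Strong fp-injectivity of cofree representations *)

Section CofreeSfp.
Variables (R : pzRingType) (Q : quiver).
Hypotheses (Q_finite : locally_target_finite Q) (Q_wf : well_founded (@arrow_rel Q)).

Lemma near_arrows (L : Type) (F : set_system L) (i : Q) (P : out_arrow i -> L -> Prop) :
  Filter F -> (forall a, \forall l \near F, P a l) -> \forall l \near F, forall a, P a l.
Proof.
move=> FF near_P; have /(@finite_seqP {classic out_arrow i})[s sE] := Q_finite i.
have near_s : \forall l \near F, forall a, a \in s -> P a l.
  elim: s {sE} => [|a s IH]; first exact: filterE.
  apply: filterS2 (near_P a) IH => l Pa Ps b; rewrite inE => /orP[/eqP -> //|]; exact: Ps.
apply: filterS near_s => l Ps a; apply: Ps.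
by have : [set: out_arrow i]%classic a by []; rewrite sE.
Qed.

(** A path is empty or starts with one of finitely many arrows, so induction over the targets
    reduces the claim to finite intersections. *)
Lemma near_paths (L : Type) (F : set_system L) (i : Q) (P : out_path i -> L -> Prop) :
  Filter F -> (forall p, \forall l \near F, P p l) -> \forall l \near F, forall p, P p l.
Proof.
move=> FF; elim/(well_founded_ind Q_wf): i => i IH in P * => near_P.
have near_cons : \forall l \near F, forall a (p : out_path (tag a)), P (out_cons a p) l.
  by apply: near_arrows => a; apply: IH => [|p]; [exact: inhabits (tagged a) | apply: near_P].
apply: filterS2 (near_P (out_nil i)) near_cons => l Pn Pc p.
by have [->|[a [q ->]]] := out_pathP p.
Qed.

(** Structure maps of cofree representations merely select coordinates, so the approximate
    retraction taken in each coordinate commutes with them. [A] and [B] are arbitrary because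
    [pure_coresolution] quantifies over all factorizations. *)
Lemma cofree_pure (L E Z : Q -> lmodType R) (e : forall j, {linear L j -> E j})
    (q : forall j, {linear E j -> Z j}) (A B : rep R Q) (u : rep_hom A (cofree E))
    (p : rep_hom (cofree E) B) :
    (forall j, injective (e j)) -> (forall j, exact_at (e j) (q j)) ->
    (forall j, fp_lifting (q j)) -> rep_short_exact u p ->
    (forall i x, p i x = 0 <-> exists y, cofree_functor e i y = x) ->
  pure_short_exact u p.
Proof.
move=> e_inj eq_exact q_lift [u_mono up_exact p_epi] pE; split=> // S.
have [Lam [F [r [PF [r_id r_lin]]]]] := approx_retraction_exists e_inj eq_exact q_lift.
have FF : Filter F by case: PF.
pose rho l i (y : cofree E i) : cofree L i := fun p => r l (tag p) (y p).
have rho_im l i y : exists a, u i a = cofree_functor e i (rho l i y).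
  by apply/up_exact/pE; exists (rho l i y).
pose rA l i y := projT1 (cid (rho_im l i y)).
have rAE l i y : u i (rA l i y) = cofree_functor e i (rho l i y).
  exact: projT2 (cid (rho_im l i y)).
have inj : injective (tensor_map S u).
  apply: (tensor_map_inj (F := F) (r := rA)).
    split=> [i a|i c b b'].
      have /pE[y yE] : p i (u i a) = 0 by apply/up_exact; exists a.
      have near_id := near_paths (P := fun p l => r l _ (e _ (y p)) = y p)
        FF (fun p => r_id _ (y p)).
      apply: filterS near_id => l yP; apply: (u_mono i).
      rewrite rAE -yE; congr (cofree_functor e i _).
      by apply: functional_extensionality_dep => t; apply: yP.
    have near_lin := near_paths
      (P := fun p l => r l _ (c *: b p + b' p) = c *: r l _ (b p) + r l _ (b' p))
      FF (fun p => r_lin _ c (b p) (b' p)).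
    apply: filterS near_lin => l yP; apply: (u_mono i).
    rewrite linearP !rAE -linearP; congr (cofree_functor e i _).
    by apply: functional_extensionality_dep => t; apply: yP.
  move=> i j a y; apply: filterE => l; apply: (u_mono j).
  by rewrite rep_hom_natural !rAE -rep_hom_natural.
by split=> //; [apply: tensor_map_exact | apply: tensor_map_surj].
Qed.

Lemma cofree_sfp (L : Q -> lmodType R) :
  (forall j, strongly_fp_injective_module (L j)) -> strongly_fp_injective_rep (cofree L).
Proof.
(* Modules are packed with their proof of strong fp-injectivity, so that one cosyzygy step becomes a
   function on [T] that can be iterated at every vertex. *)
move=> L_sfp; pose T := {V : lmodType R | strongly_fp_injective_module V}.
have step (V : T) :
    exists D : {E : lmodType R & {Z : T & ({linear sval V -> E} * {linear E -> sval Z})%type}},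
    [/\ injective_module (tag D), fp_lifting (tagged (tagged D)).2
      & [/\ injective (tagged (tagged D)).1, exact_at (tagged (tagged D)).1 (tagged (tagged D)).2
          & surj (tagged (tagged D)).2]].
  case: V => V V_sfp; have [E [Z [e [q [E_inj Z_sfp q_lift ex]]]]] := sfp_coresolution_step V_sfp.
  pose ZZ : T := exist _ Z Z_sfp.
  by exists (existT
    (fun E : lmodType R => {Z : T & ({linear V -> E} * {linear E -> sval Z})%type}) E
    (existT (fun Z : T => ({linear V -> E} * {linear E -> sval Z})%type) ZZ (e, q))).
have [D DP] := dep_choice step.
pose nxt (V : T) : T := tag (tagged (D V)).
pose hull (V : T) : lmodType R := tag (D V).
pose e (V : T) : {linear sval V -> hull V} := (tagged (tagged (D V))).1.
pose q (V : T) : {linear hull V -> sval (nxt V)} := (tagged (tagged (D V))).2.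
have hull_inj V : injective_module (hull V) by case: (DP V).
have q_lift V : fp_lifting (q V) by case: (DP V).
have e_inj V : injective (e V) by case: (DP V) => _ _ [].
have eq_exact V : exact_at (e V) (q V) by case: (DP V) => _ _ [].
have q_surj V : surj (q V) by case: (DP V) => _ _ [].
pose Z n j : T := iter n nxt (exist _ (L j) (L_sfp j)).
pose d n : rep_hom (cofree (fun j => hull (Z n j))) (cofree (fun j => hull (Z n.+1 j))) :=
  cofree_functor (fun j => e (Z n.+1 j) \o q (Z n j)).
have d_ker n i x : d n i x = 0 <->
    exists y, cofree_functor (fun j => e (Z n j)) i y = x.
  rewrite -(cofree_functor_exact (fun j => eq_exact (Z n j))).
  have mono := cofree_functor_mono (fun j => e_inj (Z n.+1 j)).
  by apply: (injective_eq0 (mono i)).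
exists (fun n => cofree (fun j => hull (Z n j))), (cofree_functor (fun j => e (Z 0%N j))), d.
split; first by move=> n; apply: cofree_injective.
split.
- by apply: cofree_functor_mono => j; apply: (e_inj (Z 0%N j)).
- by move=> i x; apply: d_ker.
- move=> n i x; rewrite d_ker; split=> [[y <-]|[y <-]].
    have [z <-] := cofree_functor_epi (fun j => q_surj (Z n j)) y.
    by exists z.
  by exists (cofree_functor (fun j => q (Z n j)) i y).
- move=> n A B u p m ex m_mono mpE.
  apply: (cofree_pure (e := fun j => e (Z n j)) (q := fun j => q (Z n j))) => //.
  move=> i x; rewrite -d_ker -mpE; apply: iff_sym.
  exact: injective_eq0 (m_mono i) _.
Qed.

End CofreeSfp.

(** * Gorenstein strongly fp-injective modules *)

Section GorensteinModules.
Variable R : pzRingType.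
Implicit Types N K L B D : lmodType R.

Definition sfp_acyclic (E : int -> lmodType R) (d : forall n, {linear E n -> E (n - 1)}) : Prop :=
  [/\ forall n, injective_module (E n), forall n, exact_at (d n) (d (n - 1))
    & forall J, strongly_fp_injective_module J ->
        forall n, Hom_exact_at J (d n) (d (n - 1))].

Lemma Gorenstein_of_cycle (E : int -> lmodType R) (d : forall n, {linear E n -> E (n - 1)})
    (m : int) N (k : {linear N -> E m}) :
  sfp_acyclic d -> injective k -> exact_at k (d m) -> Gorenstein_sfp_injective_module N.
Proof.
move=> [E_inj d_exact d_Hom] k_inj k_exact.
have shift n : n + m - 1 = n - 1 + m by rewrite addrAC.
(* n + m - 1 and n - 1 + m are equal but not convertible, whence the transport. *)
pose d' n : {linear E (n + m) -> E (n - 1 + m)} :=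
  ecast z {linear E (n + m) -> E z} (shift n) (d (n + m)).
exists (fun n => E (n + m)), d'; split=> //.
- move=> n; rewrite /d'; move: (shift n) (shift (n - 1)).
  by move: (n - 1 + m) (n - 1 - 1 + m) => z w E1; destruct E1 => E2; destruct E2; apply: d_exact.
- move=> J J_sfp n; rewrite /d'; move: (shift n) (shift (n - 1)).
  by move: (n - 1 + m) (n - 1 - 1 + m) => z w E1; destruct E1 => E2; destruct E2; apply: d_Hom.
- have : 0 + m = m by rewrite add0r.
  rewrite /d'; move: (shift 0); move: (0 + m) (0 - 1 + m) => m' z E1 E2.
  by destruct E1; destruct E2; exists k.
Qed.

(** [E] is the degree 0 term of the complex and [D] its cycles in degree -1. All cokernels are
    allowed because the later one is a kernel of [psi], a cokernel only up to isomorphism. *)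
Lemma Gorenstein_cosyzygy K : Gorenstein_sfp_injective_module K ->
  exists (E : lmodType R) (e : {linear K -> E}), [/\ injective_module E, injective e &
    forall D (q : {linear E -> D}), exact_at e q -> surj q ->
        Gorenstein_sfp_injective_module D].
Proof.
move=> [E [d [E_inj d_exact d_Hom [k [k_inj k_exact]]]]].
exists (E 0), k; split=> // D q kq_exact q_surj.
have [|k' k'E] := @factor_surj _ _ _ _ q (d 0) q_surj.
  by move=> x /kq_exact /k_exact.
apply: (@Gorenstein_of_cycle E d (0 - 1) D k') => //.
- move=> x y; have [[a <-] [b <-]] := (q_surj x, q_surj y); rewrite !k'E => /eqP.
  rewrite -subr_eq0 -linearB => /eqP/k_exact/kq_exact.
  by rewrite linearB => /eqP; rewrite subr_eq0 => /eqP.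
- move=> y; apply: iff_trans (d_exact 0 y) _; split=> [[x <-]|[z <-]].
    by exists (q x).
  by have [x <-] := q_surj z; exists x.
Qed.

Lemma Gorenstein_syzygy K : Gorenstein_sfp_injective_module K ->
  exists (E : lmodType R) (q : {linear E -> K}), [/\ injective_module E, surj q &
    forall D (e : {linear D -> E}), injective e -> exact_at e q ->
        Gorenstein_sfp_injective_module D].
Proof.
move=> [E [d [E_inj d_exact d_Hom [k [k_inj k_exact]]]]].
have [|q qE] := @lift_inj _ _ _ _ k (d 1 : {linear E 1 -> E 0}) k_inj.
  by move=> x; apply/k_exact/(d_exact 1); exists x.
exists (E 1), q; split=> //.
  move=> y; have /(d_exact 1)[x xE] : d 0 (k y) = 0 by apply/k_exact; exists y.
  by exists x; apply: k_inj; rewrite qE.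
move=> D e e_inj eq_exact; apply: (@Gorenstein_of_cycle E d 1 D e) => // x.
by apply: iff_trans (eq_exact x); rewrite -(injective_eq0 k_inj (q x)) qE.
Qed.

(** In effect Ext^1(L, K) = 0. If h extends K -> E_0 to B and g : D -> E_(-1) is induced by it, then
    B is the pullback of g and d_0. Exactness of Hom(L, E) lifts g u to v0 : L -> E_0, and the pair
    of u and v0 is the desired map to B. *)
Lemma Gorenstein_lift K B D L (k : {linear K -> B}) (p : {linear B -> D}) (u : {linear L -> D}) :
    Gorenstein_sfp_injective_module K -> strongly_fp_injective_module L ->
    injective k -> exact_at k p -> surj p ->
  exists v : {linear L -> B}, forall x, p (v x) = u x.
Proof.
move=> [E [d [E_inj d_exact d_Hom [e [e_inj e_exact]]]]] L_sfp k_inj kp_exact p_surj.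
have [h hE] := E_inj 0 _ _ k e k_inj.
have [|g gE] := @factor_surj _ _ _ _ p (d 0 \o h) p_surj.
  by move=> b /kp_exact[x <-]; rewrite /= hE (exact_comp0 e_exact).
have dg b : d (0 - 1) (g b) = 0.
  by have [c <-] := p_surj b; rewrite gE (exact_comp0 (d_exact 0)).
have [|v0 v0E] := (d_Hom L L_sfp 0 (g \o u)).1; first by move=> x; apply: dg.
have [||b [pb hb]|v vE] := @linear_of_rel _ _ _ (fun x b => p b = u x /\ h b = v0 x).
- move=> x; have [b bE] := p_surj (u x).
  have /e_exact[y yE] : d 0 (h b - v0 x) = 0.
    by rewrite linearB v0E /= -bE gE subrr.
  exists (b - k y); rewrite !linearB hE yE bE (exact_comp0 kp_exact) subr0.
  by split=> //; rewrite subKr.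
- by move=> a x x' b b' [pb hb] [pb' hb']; rewrite !linearP pb hb pb' hb'.
- have /kp_exact[y yE] : p b = 0 by rewrite pb linear0.
  by rewrite -yE (_ : y = 0) ?linear0 //; apply: e_inj; rewrite -hE yE hb !linear0.
by exists v => x; case: (vE x).
Qed.

End GorensteinModules.

Lemma int_chain (T : Type) (P : T -> Prop) (r : T -> T -> Prop) (x0 : T) :
    P x0 -> (forall x, P x -> exists2 y, P y & r x y) ->
    (forall x, P x -> exists2 y, P y & r y x) ->
  exists z : int -> T, [/\ z (- 1) = x0, forall n, P (z n) & forall n, r (z n) (z (n - 1))].
Proof.
move=> Px0 ex_down ex_up; pose S := {x | P x}.
have [down downP] : exists down : S -> S, forall x, r (sval x) (sval (down x)).
  suff /choice[h hP] : forall x : S, exists y : S, r (sval x) (sval y) by exists h.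
  by case=> x Px; have [y Py rxy] := ex_down x Px; exists (exist _ y Py).
have [up upP] : exists up : S -> S, forall x, r (sval (up x)) (sval x).
  suff /choice[h hP] : forall x : S, exists y : S, r (sval y) (sval x) by exists h.
  by case=> x Px; have [y Py rxy] := ex_up x Px; exists (exist _ y Py).
pose s0 : S := exist _ x0 Px0.
(* [Negz 0] is -1, where the chain starts; an index m at least 0 lies m + 1 steps above it. *)
pose z n := match n with Posz m => iter m.+1 up s0 | Negz m => iter m down s0 end.
exists (fun n => sval (z n)); split=> [//|n|]; first exact: svalP (z n).
case=> [[|m]|m]; first exact: upP.
  have -> : m.+1%:Z - 1 = m%:Z by rewrite intS addrC addKr.
  exact: upP.
have -> : Negz m - 1 = Negz m.+1 by rewrite !NegzE -opprD addrC -intS.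
exact: downP.
Qed.

(** * Syzygies, cosyzygies and lifting from conditions on [psi] *)

Section GorensteinClass.
Variables (R : pzRingType) (Q : quiver).
Hypothesis Q_wf : well_founded (@arrow_rel Q).
Implicit Types X Y Z J : rep R Q.

Definition psi_gorenstein X : Prop :=
  forall i, Gorenstein_sfp_injective_module (kernel (psi X i)) /\ surj (psi X i).

(** Given the lift at the targets, the admissible values at an x in J(i) form a coset of k(Ker
    psi_i^X). They define one linear map from J(i) to the quotient of Y(i) by this submodule, and
    [Gorenstein_lift] lifts that map. *)
Lemma psi_gorenstein_lift X Y Z J (k : rep_hom X Y) (p : rep_hom Y Z) (u : rep_hom J Z) :
    psi_gorenstein X -> strongly_fp_injective_rep J -> rep_short_exact k p ->
  exists v : rep_hom J Y, forall i x, p i (v i x) = u i x.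
Proof.
move=> X_gor /sfp_rep_at J_sfp [k_mono kp_exact p_epi].
apply: (rep_hom_rec Q_wf (P := fun i (w : {linear J i -> Y i}) =>
  forall x, p i (w x) = u i x)) => i v vE.
have [K_gor psi_surj] := X_gor i.
have [D [q [q_exact q_surj]]] := cokernel_exists (k i \o kernel_incl (psi X i)).
pose good x y := p i y = u i x /\ psi Y i y = fun a => v a (psi J i x a).
have [||_ [y [<- [py psi_y]]]|w wE] :=
    @linear_of_rel _ (J i) D (fun x z => exists y, q y = z /\ good x y).
- move=> x; have [y0 y0E] := p_epi i (u i x).
  (* The discrepancy at each target comes from X; surjectivity of [psi X] turns the family into a
     single correction from X(i). *)
  have diff a : exists z, k (tag a) z = psi Y i y0 a - v a (psi J i x a).
    apply/kp_exact; rewrite linearB vE.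
    rewrite -[p (tag a) _]/(psi_map p (psi Y i y0) a) -psi_natural y0E psi_natural.
    exact: subrr.
  have [z zE] := dep_choice diff; have [x0 x0E] := psi_surj z.
  exists (q (y0 - k i x0)), (y0 - k i x0); split=> //; split.
    by rewrite linearB y0E (exact_comp0 (kp_exact i)) subr0.
  rewrite linearB psi_natural x0E; apply: functional_extensionality_dep => a.
  by rewrite -[LHS]/(psi Y i y0 a - k (tag a) (z a)) zE subKr.
- move=> a x x' _ _ [y [<- [py psi_y]]] [y' [<- [py' psi_y']]].
  exists (a *: y + y'); rewrite !linearP; split=> //; split.
    by rewrite linearP py py' linearP.
  rewrite linearP psi_y psi_y'; apply: functional_extensionality_dep => b.
  have -> : psi J i (a *: x + x') b = a *: psi J i x b + psi J i x' b by rewrite linearP.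
  by rewrite linearP.
- have /kp_exact[x xE] : p i y = 0 by rewrite py linear0.
  have /kernel_incl_exact[z zE] : psi X i x = 0.
    apply: functional_extensionality_dep => a; apply: (k_mono (tag a)).
    rewrite -[LHS]/(psi_map k (psi X i x) a) -psi_natural xE psi_y.
    by rewrite linear0 -[RHS]/(k (tag a) 0) !linear0.
  by apply/q_exact; exists z; rewrite /= zE.
have inj : injective (k i \o kernel_incl (psi X i)).
  by move=> x y /k_mono/kernel_incl_inj.
have [w' w'E] := Gorenstein_lift w K_gor (J_sfp i) inj q_exact q_surj.
have w'_good x : good x (w' x).
  have [y [qy [py psi_y]]] := wE x.
  have /q_exact[z zE] : q (w' x - y) = 0 by rewrite linearB w'E qy subrr.
  have w'xE : w' x = k i (kernel_incl _ z) + y.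
    by rewrite -[k i _]/((k i \o kernel_incl (psi X i)) z) zE subrK.
  rewrite /good w'xE !linearD py psi_y (exact_comp0 (kp_exact i)) add0r; split=> //.
  rewrite psi_natural (exact_comp0 (@kernel_incl_exact _ _ _ _)).
  apply: functional_extensionality_dep => a.
  by rewrite -[LHS]/(k (tag a) 0 + v a (psi J i x a)) linear0 add0r.
exists w' => [x|a x]; first by case: (w'_good x).
by case: (w'_good x) => _ ->.
Qed.

(** C(E) has psi-kernels E(i), and [psi X] is epi, so the snake lemma identifies Ker psi_i^Y with
    E(i) / Ker psi_i^X. This is Gorenstein for the E(i) supplied by [Gorenstein_cosyzygy]. *)
Lemma psi_gorenstein_cosyzygy X : psi_gorenstein X ->
  exists (I Y : rep R Q) (k : rep_hom X I) (p : rep_hom I Y),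
    [/\ injective_rep I, rep_short_exact k p & psi_gorenstein Y].
Proof.
move=> X_gor.
have hull i : exists E : lmodType R, exists e : {linear kernel (psi X i) -> E},
    [/\ injective_module E, injective e &
      forall (D : lmodType R) (q : {linear E -> D}), exact_at e q -> surj q ->
        Gorenstein_sfp_injective_module D].
  by apply: Gorenstein_cosyzygy; case: (X_gor i).
pose E i := projT1 (cid (hull i)).
have [e eP] := dep_choice (fun i => projT2 (cid (hull i))).
have E_inj i : injective_module (E i) by case: (eP i).
have [g gE] := dep_choice (fun i =>
  E_inj i _ _ (kernel_incl (psi X i)) (e i) (@kernel_incl_inj _ _ _ _)).
pose k := cofree_adj g.
have k_ker i x : k i x = 0 -> x = 0.
  elim/(well_founded_ind Q_wf): i x => i IH x kx0.
  have /kernel_incl_exact[y yE] : psi X i x = 0.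
    apply: functional_extensionality_dep => a; apply: (IH _ (inhabits (tagged a))).
    by rewrite rep_hom_natural kx0 linear0.
  have : cofree_eval _ i (k i x) = 0 by rewrite kx0 linear0.
  rewrite cofree_eval_adj -yE gE; case: (eP i) => _ e_inj _ /(injective_eq0 e_inj) ->.
  exact: linear0.
have k_mono : rep_mono k.
  move=> i x y xy; apply/eqP; rewrite -subr_eq0; apply/eqP/(k_ker i).
  by rewrite linearB xy subrr.
have [Y [p [p_epi kp_exact]]] := cokernel_rep_exists k.
exists (cofree E), Y, k, p; split=> //; first exact: cofree_injective.
move=> i; split; last first.
  move=> z; have [y yE] := dep_choice (fun a : out_arrow i => p_epi (tag a) (z a)).
  exists (p i (cofree_cons E i y)); rewrite psi_natural cofree_psiK.
  exact: functional_extensionality_dep.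
have psi_pnil x : psi Y i (p i (cofree_nil E i x)) = 0.
  rewrite psi_natural psi_cofree_nil; apply: functional_extensionality_dep => a.
  exact: linear0.
have [|q qE] := @lift_inj _ _ _ _ (kernel_incl (psi Y i)) (p i \o cofree_nil E i)
    (@kernel_incl_inj _ _ _ _).
  by move=> x; apply/kernel_incl_exact/psi_pnil.
case: (eP i) => _ e_inj; apply.
  move=> x; apply: iff_trans (iff_sym (injective_eq0 (@kernel_incl_inj _ _ _ (psi Y i)) (q x))) _.
  rewrite qE; apply: iff_trans (kp_exact i _) _.
  split=> [[y kyE]|[y <-]].
    have /kernel_incl_exact[z zE] : psi X i y = 0.
      apply: functional_extensionality_dep => a; apply: (k_ker (tag a)).
      rewrite -[LHS]/(psi_map k (psi X i y) a) -psi_natural kyE.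
      by rewrite psi_cofree_nil.
    by exists z; rewrite -gE zE -cofree_eval_adj -/k kyE cofree_evalK.
  exists (kernel_incl _ y); rewrite [LHS]cofree_ker_psi.
    by rewrite cofree_eval_adj gE.
  rewrite psi_natural (exact_comp0 (@kernel_incl_exact _ _ _ _)).
  by apply: functional_extensionality_dep => a; apply: linear0.
(* Changing the preimage [c] by an element of X(i) makes [psi] vanish on it, which places it in the
   summand E(i). *)
move=> y; have [c cE] := p_epi i (kernel_incl _ y).
have c_lift (a : out_arrow i) : exists z, k (tag a) z = psi _ i c a.
  apply/kp_exact; rewrite -[LHS]/(psi_map p (psi _ i c) a) -psi_natural cE.
  by rewrite (exact_comp0 (@kernel_incl_exact _ _ _ _)).
have [z zE] := dep_choice c_lift; have [x xE] := (X_gor i).2 z.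
have psi0 : psi _ i (c - k i x) = 0.
  rewrite linearB psi_natural xE; apply/eqP; rewrite subr_eq0; apply/eqP.
  by apply: functional_extensionality_dep => a; rewrite -zE.
exists (cofree_eval E i (c - k i x)); apply: (@kernel_incl_inj _ _ _ (psi Y i)).
rewrite qE -[LHS]/(p i (cofree_nil E i _)) -cofree_ker_psi //.
by rewrite linearB (exact_comp0 (kp_exact i)) subr0.
Qed.

(** E(i) covers Ker psi_i^X, and [cofree_out] extends these covers to C(E) -> X. The lifts along
    [psi X] that it asks for exist by [Gorenstein_lift], as the values of C(E) are injective and
    hence strongly fp-injective. *)
Lemma psi_gorenstein_syzygy X : psi_gorenstein X ->
  exists (I Y : rep R Q) (k : rep_hom Y I) (p : rep_hom I X),
    [/\ injective_rep I, rep_short_exact k p & psi_gorenstein Y].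
Proof.
move=> X_gor.
have cover i : exists E : lmodType R, exists q : {linear E -> kernel (psi X i)},
    [/\ injective_module E, surj q &
      forall (D : lmodType R) (e : {linear D -> E}), injective e -> exact_at e q ->
        Gorenstein_sfp_injective_module D].
  by apply: Gorenstein_syzygy; case: (X_gor i).
pose E i := projT1 (cid (cover i)).
have [q qP] := dep_choice (fun i => projT2 (cid (cover i))).
have E_inj i : injective_module (E i) by case: (qP i).
have [||p pE] := @cofree_out _ _ Q_wf E X (fun i => kernel_incl (psi X i) \o q i).
- by move=> i x; apply/kernel_incl_exact; exists (q i x).
- move=> i u; case: (X_gor i) => K_gor psi_surj.
  apply: (Gorenstein_lift u K_gor _ (@kernel_incl_inj _ _ _ (psi X i))) => //.
    by apply/injective_module_sfp/prod_injective_module.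
  exact: kernel_incl_exact.
have p_epi : rep_epi p.
  apply: (rep_epi_by_ker Q_wf).
    by move=> i z; exists (cofree_cons E i z); apply: cofree_psiK.
  move=> i _ /kernel_incl_exact[y <-].
  by case: (qP i) => _ /(_ y)[x <-] _; exists (cofree_nil E i x); rewrite pE.
have [Y [k [k_mono k_exact]]] := kernel_rep_exists p.
exists (cofree E), Y, k, p; split=> //; first exact: cofree_injective.
move=> i; case: (qP i) => _ q_surj q_gor; split; last first.
  move=> z; pose c := cofree_cons E i (psi_map k z).
  have psi_c : psi _ i c = psi_map k z by apply: cofree_psiK.
  have /kernel_incl_exact[y yE] : psi X i (p i c) = 0.
    rewrite psi_natural psi_c; apply: functional_extensionality_dep => a.
    exact: (exact_comp0 (k_exact (tag a))).
  have [x xE] := q_surj y.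
  have /k_exact[t tE] : p i (c - cofree_nil E i x) = 0.
    by rewrite linearB pE /= xE yE subrr.
  exists t; apply: functional_extensionality_dep => a; apply: (k_mono (tag a)).
  rewrite -[LHS]/(psi_map k (psi Y i t) a) -psi_natural tE linearB psi_c psi_cofree_nil.
  by rewrite subr0.
have psi_k y : psi _ i (k i (kernel_incl (psi Y i) y)) = 0.
  rewrite psi_natural (exact_comp0 (@kernel_incl_exact _ _ _ _)).
  by apply: functional_extensionality_dep => a; apply: linear0.
apply: (q_gor _ (cofree_eval E i \o k i \o kernel_incl (psi Y i))).
  move=> y y' yy'; apply: (@kernel_incl_inj _ _ _ (psi Y i)); apply: (k_mono i).
  by rewrite (cofree_ker_psi (psi_k y)) (cofree_ker_psi (psi_k y')); congr (cofree_nil E i _).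
move=> x; apply: iff_trans (iff_sym (injective_eq0 (@kernel_incl_inj _ _ _ (psi X i)) (q i x))) _.
rewrite -[kernel_incl _ _]/((kernel_incl (psi X i) \o q i) x) -pE.
apply: iff_trans (k_exact i _) _; split=> [[y yE]|[y <-]].
  have /kernel_incl_exact[z zE] : psi Y i y = 0.
    apply: functional_extensionality_dep => a; apply: (k_mono (tag a)).
    rewrite -[LHS]/(psi_map k (psi Y i y) a) -psi_natural yE psi_cofree_nil.
    by rewrite -[RHS]/(k (tag a) 0) linear0.
  by exists z; rewrite -[LHS]/(cofree_eval E i (k i (kernel_incl (psi Y i) z))) zE yE.
by exists (kernel_incl _ y); rewrite {1}(cofree_ker_psi (psi_k y)).
Qed.

Lemma psi_gorenstein_rep X : psi_gorenstein X -> Gorenstein_sfp_injective_rep X.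
Proof.
move=> X_gor.
pose r Y Z := exists (I : rep R Q) (D : rep_hom Y I * rep_hom I Z),
  injective_rep I /\ rep_short_exact D.1 D.2.
have [|||Z [ZX Z_gor Z_r]] := @int_chain _ psi_gorenstein r X.
- exact: X_gor.
- move=> Y /psi_gorenstein_cosyzygy[I [Y' [k [p [I_inj ex Y'_gor]]]]].
  by exists Y' => //; exists I, (k, p).
- move=> Y /psi_gorenstein_syzygy[I [Y' [k [p [I_inj ex Y'_gor]]]]].
  by exists Y' => //; exists I, (k, p).
pose I n := projT1 (cid (Z_r n)).
have [D DP] := dep_choice (fun n => projT2 (cid (Z_r n))).
pose k n : rep_hom (Z n) (I n) := (D n).1.
pose p n : rep_hom (I n) (Z (n - 1)) := (D n).2.
have k_mono n : rep_mono (k n) by case: (DP n) => _ [].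
have p_epi n : rep_epi (p n) by case: (DP n) => _ [].
have kp_exact n : rep_exact_at (k n) (p n) by case: (DP n) => _ [].
pose d n : rep_hom (I n) (I (n - 1)) := rep_comp (k (n - 1)) (p n).
have d0 n i x : d n i x = 0 <-> exists y, k n i y = x.
  rewrite -(kp_exact n i x); exact: injective_eq0 (k_mono (n - 1) i) _.
exists I, d; split.
- by move=> n; case: (DP n).
- move=> n i x; rewrite d0; split=> [[y <-]|[y <-]].
    by have [y' <-] := p_epi n i y; exists y'.
  by exists (p n i y).
- move=> J J_sfp n u; split=> [u0|[v vE]].
    have [|u' u'E] := rep_lift_mono (u := u) (k_mono (n - 1)).
      by move=> i x; apply/d0/u0.
    have [_ ex] := DP n.
    have [v vE] := psi_gorenstein_lift u' (Z_gor n) J_sfp ex.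
    by exists v => i x; rewrite -u'E -vE.
  by move=> i x; rewrite -vE; apply/d0; exists (p n i (v i x)).
- rewrite -[X]ZX; exists (k (- 1)); split=> //.
  by move=> i x; apply: d0.
Qed.

End GorensteinClass.

(** * Cycles of acyclic complexes of injective representations *)

Section AcyclicComplexes.
Variables (R : pzRingType) (Q : quiver).
Hypotheses (Q_finite : locally_target_finite Q) (Q_wf : well_founded (@arrow_rel Q)).
Variables (I : int -> rep R Q) (f : forall n, rep_hom (I n) (I (n - 1))).
Hypotheses (I_inj : forall n, injective_rep (I n))
  (f_exact : forall n, rep_exact_at (f n) (f (n - 1)))
  (f_Hom : forall J, strongly_fp_injective_rep J ->
     forall n, rep_Hom_exact_at J (f n) (f (n - 1))).

Section ConeMap.
Variables (i : Q) (L : lmodType R).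

(** L at i and 0 elsewhere; functions on the proposition j = i avoid a case distinction in the
    type. *)
Definition point_module (j : Q) : lmodType R := prodmod (fun _ : j = i => L).
Definition arrow_module (j : Q) : lmodType R := prodmod (fun _ : arr j i => L).

Definition cone_map_at (j : Q) : {linear cofree point_module j -> arrow_module j} :=
  prod_pair (fun a : arr j i => prod_proj (fun _ : i = i => L) erefl \o
    (cofree_eval point_module i \o rep_map (cofree point_module) a)).

(** The source has at j one copy of L for each path from j to i, the target one for each path
    followed by an arrow into i, that is, for each nonempty path to i. The map forgets the
    coordinate of the empty path, so its kernel is the stalk of L at i. *)
Definition cone_map : rep_hom (cofree point_module) (cofree arrow_module) :=
  cofree_adj cone_map_at.

Lemma cone_map_nil j x : cone_map j (cofree_nil point_module j x) = 0.
Proof.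
apply: cofree_eq0.
  rewrite psi_natural psi_cofree_nil; apply: functional_extensionality_dep => a.
  exact: linear0.
rewrite cofree_eval_adj; apply: functional_extensionality_dep => a.
have -> : cone_map_at j (cofree_nil point_module j x) a =
  cofree_eval point_module i
    (psi (cofree point_module) j (cofree_nil point_module j x) (Tagged _ a)) erefl by [].
by rewrite psi_cofree_nil.
Qed.

Lemma cone_map_ker j x : cone_map j x = 0 -> psi (cofree point_module) j x = 0.
Proof.
elim/(well_founded_ind Q_wf): j x => j IH x px0.
apply: functional_extensionality_dep => -[k a].
suff : rep_map (cofree point_module) a x = 0 by [].
apply: cofree_eq0.
  by apply: (IH k (inhabits a)); rewrite rep_hom_natural px0 linear0.
apply: functional_extensionality_dep => E; subst k.
exact: (congr1 (fun y => cofree_eval arrow_module j y a) px0).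
Qed.

Lemma cone_map_epi : rep_epi cone_map.
Proof.
apply: (rep_epi_by_ker Q_wf).
  by move=> j z; exists (cofree_cons point_module j z); apply: cofree_psiK.
move=> j z /cofree_ker_psi; move: (cofree_eval arrow_module j z) => c ->.
pose b : prodmod (fun a : out_arrow j => cofree point_module (tag a)) :=
  fun a => cofree_nil point_module (tag a)
    (fun E : tag a = i => c (ecast k (arr j k) E (tagged a))).
exists (cofree_cons point_module j b).
have psi0 : psi (cofree arrow_module) j (cone_map j (cofree_cons point_module j b)) = 0.
  rewrite psi_natural cofree_psiK; apply: functional_extensionality_dep => a.
  exact: cone_map_nil.
by rewrite (cofree_ker_psi psi0).
Qed.

End ConeMap.

(* Extend u from the vertex i to cofree (point_module i L); its image under f
   then factors through cone_map, and both of these cofree representations are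
   strongly fp-injective. *)
Lemma kernel_psi_lift i (L : lmodType R) n (u : {linear L -> I (n - 1) i}) :
    strongly_fp_injective_module L ->
    (forall x, f (n - 1) i (u x) = 0) -> (forall x, psi (I (n - 1)) i (u x) = 0) ->
  exists v : {linear L -> I n i},
    (forall x, f n i (v x) = u x) /\ (forall x, psi (I n) i (v x) = 0).
Proof.
move=> L_sfp fu0 psi_u0.
pose e := cofree (point_module i L); pose C := cofree (arrow_module i L).
have e_sfp : strongly_fp_injective_rep e.
  by apply: (cofree_sfp Q_finite Q_wf) => j; apply: prod_sfp_module.
have C_sfp : strongly_fp_injective_rep C.
  by apply: (cofree_sfp Q_finite Q_wf) => j; apply: prod_sfp_module.
have [g gP] : exists g : forall j, {linear point_module i L j -> I (n - 1) j},
    forall j, [/\ forall x, f (n - 1) j (g j x) = 0, forall x, psi (I (n - 1)) j (g j x) = 0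
      & forall (E : j = i) x, ecast k (I (n - 1) k) E (g j x) = u (x E)].
  apply: (dep_choice (P := fun j (h : {linear point_module i L j -> I (n - 1) j}) =>
    [/\ forall x, f (n - 1) j (h x) = 0, forall x, psi (I (n - 1)) j (h x) = 0
      & forall (E : j = i) x, ecast k (I (n - 1) k) E (h x) = u (x E)])) => j.
  have [E|nE] := pselect (j = i); last by exists \0; split=> [x|x|//]; apply: linear0.
  subst j; exists (u \o prod_proj (fun _ : i = i => L) erefl).
  by split=> [x|x|E x]; [apply: fu0 | apply: psi_u0 | rewrite (Prop_irrelevance E erefl)].
have [||h hE] := @cofree_out _ _ Q_wf (point_module i L) (I (n - 1)) g.
- by move=> j x; case: (gP j).
- move=> j w; have [t tE] := injective_rep_psi_section (@I_inj (n - 1)) j.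
  by exists (t \o w) => x; rewrite -[RHS]tE.
have [|w wE] := rep_factor_epi (q := cone_map i L) (u := rep_comp (f (n - 1)) h)
    (@cone_map_epi i L).
  move=> j x /cone_map_ker/cofree_ker_psi ->.
  by rewrite /= hE; case: (gP j).
have fw0 j y : f (n - 1 - 1) j (w j y) = 0.
  have [x <-] := @cone_map_epi i L j y; rewrite wE.
  exact: (exact_comp0 (@f_exact (n - 1) j)).
have [w' w'E] := (@f_Hom C C_sfp (n - 1) w).1 fw0.
(* Subtracting w' after [cone_map] makes h a morphism killed by f, and does not change it on the
   stalk. *)
have diff_nat j k (a : arr j k) x : (h k \- (w' k \o cone_map i L k)) (rep_map e a x) =
    rep_map (I (n - 1)) a ((h j \- (w' j \o cone_map i L j)) x).
  by rewrite linearB -!rep_hom_natural.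
have [|v vE] := (@f_Hom e e_sfp n (RepHom (X := e) diff_nat)).1.
  by move=> j x; rewrite /= linearB w'E wE /= subrr.
have const_lin : linear (fun x : L => (fun=> x) : point_module i L i) by [].
pose const : {linear L -> point_module i L i} := linear_of const_lin.
exists (v i \o cofree_nil (point_module i L) i \o const); split=> x.
  have [_ _ gu] := gP i.
  rewrite -[LHS]/(f n i (v i (cofree_nil (point_module i L) i (const x)))) vE /=.
  rewrite cone_map_nil linear0 subr0.
  by rewrite hE -(gu erefl).
rewrite -[LHS]/(psi (I n) i (v i (cofree_nil (point_module i L) i (const x)))).
rewrite psi_natural psi_cofree_nil.
by apply: functional_extensionality_dep => a; apply: linear0.
Qed.

(** Lifts of the components of psi(u) at the targets, combined by a section of [psi], leave a
    difference in Ker psi, to which [kernel_psi_lift] applies. *)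
Lemma vertex_lift i (L : lmodType R) n (u : {linear L -> I (n - 1) i}) :
    strongly_fp_injective_module L -> (forall x, f (n - 1) i (u x) = 0) ->
  exists v : {linear L -> I n i}, forall x, f n i (v x) = u x.
Proof.
move=> L_sfp; elim/(well_founded_ind Q_wf): i u => i IH u fu0.
have lift_a (a : out_arrow i) : exists v : {linear L -> I n (tag a)},
    forall x, f n (tag a) (v x) = rep_map (I (n - 1)) (tagged a) (u x).
  apply: (IH _ (inhabits (tagged a)) (rep_map (I (n - 1)) (tagged a) \o u)) => x.
  by rewrite /= rep_hom_natural fu0 linear0.
have [v vE] := dep_choice lift_a.
have [t tE] := injective_rep_psi_section (@I_inj n) i.
pose w : {linear L -> I n i} := t \o prod_pair v.
have [|x|w' [w'E _]] := kernel_psi_lift (u := u \- (f n i \o w)) L_sfp.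
- by move=> x; rewrite /= linearB fu0 sub0r (exact_comp0 (@f_exact n i)) oppr0.
- rewrite -[LHS]/(psi _ i (u x - f n i (w x))) linearB psi_natural tE.
  apply/eqP; rewrite subr_eq0; apply/eqP.
  by apply: functional_extensionality_dep => a; rewrite -[RHS]/(f n (tag a) (v a x)) vE.
by exists (w \+ w') => x; rewrite /= linearD w'E /= [LHS]addrC subrK.
Qed.

(** [psi] sends a preimage y0 of x to a family of cycles at the targets. These are boundaries, and a
    section of [psi] one degree higher gives the boundary to subtract from y0. *)
Lemma kernel_psi_exact i n x :
  f (n - 1) i x = 0 -> psi (I (n - 1)) i x = 0 ->
  exists y, f n i y = x /\ psi (I n) i y = 0.
Proof.
(* The correction comes from degree m + 1, so the degree is written m + 1 - 1 to match the type of
   the differential. *)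
pose P m := forall x : I (m - 1) i, f (m - 1) i x = 0 -> psi (I (m - 1)) i x = 0 ->
  exists y, f m i y = x /\ psi (I m) i y = 0.
suff key m : P (m + 1 - 1) by have := key n; rewrite addrK => /(_ x).
move=> {n}x fx0 psi_x0; have /f_exact[y0 y0E] := fx0.
have lift_a (a : out_arrow i) : exists y, f (m + 1) (tag a) y = psi (I (m + 1 - 1)) i y0 a.
  apply/f_exact; rewrite -[LHS]/(psi_map (f (m + 1 - 1)) (psi _ i y0) a) -psi_natural y0E.
  by rewrite psi_x0.
have [y yE] := dep_choice lift_a.
have [t tE] := injective_rep_psi_section (@I_inj (m + 1)) i.
exists (y0 - f (m + 1) i (t y)); split.
  by rewrite linearB y0E (exact_comp0 (@f_exact (m + 1) i)) subr0.
rewrite linearB psi_natural tE; apply/eqP; rewrite subr_eq0; apply/eqP.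
by apply: functional_extensionality_dep => a; rewrite -[RHS]/(f (m + 1) (tag a) (y a)) yE.
Qed.

Section Cycle.
Variables (X : rep R Q) (k : rep_hom X (I (- 1))).
Hypotheses (k_mono : rep_mono k) (k_exact : rep_exact_at k (f (- 1))).

Lemma cycle_Gorenstein i : Gorenstein_sfp_injective_module (X i).
Proof.
apply: (@Gorenstein_of_cycle R (fun n => I n i) (fun n => f n i) (- 1) (X i) (k i)) => //.
split=> [n|n|J J_sfp n u].
- exact: injective_rep_at.
- exact: f_exact.
- split=> [fu0|[v vE] x]; first exact: vertex_lift.
  by rewrite -vE (exact_comp0 (@f_exact n i)).
Qed.

Lemma cycle_kernel_Gorenstein i : Gorenstein_sfp_injective_module (kernel (psi X i)).
Proof.
pose K n := kernel_incl (psi (I n) i).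
have K_inj n : injective (K n) by apply: kernel_incl_inj.
have K_exact n : exact_at (K n) (psi (I n) i) by apply: kernel_incl_exact.
have f_kernel n (y : kernel (psi (I n) i)) : psi (I (n - 1)) i (f n i (K n y)) = 0.
  rewrite psi_natural (exact_comp0 (K_exact n)).
  by apply: functional_extensionality_dep => a; apply: linear0.
have ex_d n : exists d : {linear kernel (psi (I n) i) -> kernel (psi (I (n - 1)) i)},
    forall y, K (n - 1) (d y) = f n i (K n y).
  by apply: (lift_inj (u := f n i \o K n)) => // y; apply/K_exact/f_kernel.
have [d dE] := dep_choice ex_d.
have [|k' k'E] := lift_inj (u := k i \o kernel_incl (psi X i)) (K_inj (- 1)).
  move=> y; apply/K_exact; rewrite -[LHS]/(psi _ i (k i (kernel_incl _ y))) psi_natural.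
  rewrite (exact_comp0 (@kernel_incl_exact _ _ _ _)).
  by apply: functional_extensionality_dep => a; apply: linear0.
have fE n y : d n y = 0 <-> f n i (K n y) = 0.
  by rewrite -dE; apply: iff_sym; apply: injective_eq0 (K_inj (n - 1)) _.
apply: (@Gorenstein_of_cycle R (fun n => kernel (psi (I n) i)) d (- 1) _ k').
- split=> [n|n y|J J_sfp n u].
  + exact: injective_rep_ker_psi.
  + rewrite fE; split=> [fy0|[z <-]]; last by rewrite dE (exact_comp0 (@f_exact n i)).
    have [|z [zE /K_exact[z' z'E]]] := kernel_psi_exact fy0.
      exact: (exact_comp0 (K_exact (n - 1))).
    by exists z'; apply: (K_inj (n - 1)); rewrite dE z'E.
  + split=> [du0|[v vE] x]; last by apply/fE; rewrite -vE dE (exact_comp0 (@f_exact n i)).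
    have [||v [vE psi_v]] := kernel_psi_lift (u := K (n - 1) \o u) J_sfp.
    * by move=> x; apply/fE/du0.
    * by move=> x; apply: (exact_comp0 (K_exact (n - 1))).
    have [|v' v'E] := lift_inj (u := v) (K_inj n).
      by move=> x; apply/K_exact/psi_v.
    by exists v' => x; apply: (K_inj (n - 1)); rewrite dE v'E vE.
- move=> x y xy; apply: (@kernel_incl_inj _ _ _ (psi X i)); apply: (@k_mono i).
  by have := congr1 (K (- 1)) xy; rewrite !k'E.
- move=> y; rewrite fE; split=> [/k_exact[x xE]|[x <-]]; last first.
    by rewrite k'E; apply/k_exact; exists (kernel_incl _ x).
  have /kernel_incl_exact[z zE] : psi X i x = 0.
    apply: functional_extensionality_dep => a; apply: (@k_mono (tag a)).
    rewrite -[LHS]/(psi_map k (psi X i x) a) -psi_natural xE (exact_comp0 (K_exact (- 1))).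
    by rewrite -[RHS]/(k (tag a) 0) linear0.
  by exists z; apply: (K_inj (- 1)); rewrite k'E /= zE.
Qed.

(** X is the image of I_0 in I_(-1), and [psi] is already surjective on I_0. *)
Lemma cycle_psi_surj i : surj (psi X i).
Proof.
move=> z.
have lift_a (a : out_arrow i) : exists y : I 0 (tag a), f 0 (tag a) y = k (tag a) (z a).
  by apply/(@f_exact 0); apply/k_exact; exists (z a).
have [y yE] := dep_choice lift_a.
have [t tE] := injective_rep_psi_section (@I_inj 0) i.
have /k_exact[x xE] : f (- 1) i (f 0 i (t y)) = 0.
  exact: (exact_comp0 (@f_exact 0 i)).
exists x; apply: functional_extensionality_dep => a; apply: (@k_mono (tag a)).
rewrite -[LHS]/(psi_map k (psi X i x) a) -psi_natural xE psi_natural tE.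
exact: yE.
Qed.

End Cycle.

End AcyclicComplexes.

Theorem theoremC (R : pzRingType) (Q : quiver)
    (Q_finite : locally_target_finite Q) (Q_rooted : right_rooted Q)
    (X : rep R Q) :
  Gorenstein_sfp_injective_rep X <->
  forall i : Q,
    [/\ Gorenstein_sfp_injective_module (X i),
        Gorenstein_sfp_injective_module (kernel (psi X i))
      & surj (psi X i)].
Proof.
have Q_wf := right_rooted_wf Q_rooted.
split=> [[I [f [I_inj f_exact f_Hom [k [k_mono k_exact]]]]] i|X_gor].
  split.
  - exact: (cycle_Gorenstein Q_finite Q_wf I_inj f_exact f_Hom k_mono k_exact).
  - exact: (cycle_kernel_Gorenstein Q_finite Q_wf I_inj f_exact f_Hom k_mono k_exact).
  - exact: (cycle_psi_surj I_inj f_exact k_mono k_exact).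
by apply: psi_gorenstein_rep => // i; case: (X_gor i).
Qed.
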